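(* Let $A$ be a unital $C^*$-algebra and let $F:l_2(A)\to l_2(A)$ be a Fredholm $A$-operator. Then $F$ admits an inner (Noether) decomposition and $F$ admits an external (Noether) decomposition.
   Context: Let $A$ be a unital $C^*$-algebra. $l_2(A)$ is the Hilbert (left) $A$-module of all sequences $x=(x_1,x_2,\dots)$, $x_k\in A$, such that $\langle x,x\rangle=\sum_{k=1}^\infty x_kx_k^*$ converges in norm in $A$, with norm $\|x\|=\|\langle x,x\rangle\|^{1/2}$. An $A$-operator is an $A$-linear map; bounded $A$-operators are NOT assumed to admit an adjoint. $\mathrm{End}(l_2(A))$ is the Banach algebra of all bounded $A$-operators on $l_2(A)$. A Hilbert $A$-module is finitely generated if it is finitely generated algebraically. Compact operators: a bounded $A$-operator $K$ on $l_2(A)$ is called finitely generated if it is a composition $l_2(A)\xrightarrow{f_1}M\xrightarrow{f_2}l_2(A)$ of bounded $A$-operators with $M$ a finitely generated Hilbert $A$-module. $\mathcal K(l_2(A))$, the set of compact $A$-operators, is the operator-norm closure in $\mathrm{End}(l_2(A))$ of the set of finitely generated $A$-operators. Fredholm operators: a bounded $A$-operator $F$ on $l_2(A)$ is Fredholm if there is a bounded $A$-operator $G$ on $l_2(A)$ with $\mathrm{id}-FG\in\mathcal K(l_2(A))$ and $\mathrm{id}-GF\in\mathcal K(l_2(A))$. Inner decomposition: $F$ admits an inner (Noether) decomposition if there are (not necessarily orthogonal) direct sum decompositions into closed submodules of the source, $l_2(A)=M_1\oplus N_1$, and of the target, $l_2(A)=M_2\oplus N_2$, with $N_1,N_2$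 finitely generated Hilbert $A$-modules, in which $F$ has the matrix form $\begin{pmatrix}F_1&F_2\\0&F_4\end{pmatrix}:M_1\oplus N_1\to M_2\oplus N_2$ with $F_1:M_1\to M_2$ an isomorphism (bounded with bounded inverse). External decomposition: $F$ admits an external (Noether) decomposition if there are finitely generated Hilbert $A$-modules $X_1,X_2$ and bounded $A$-operators $E_2:X_1\to l_2(A)$, $E_3:l_2(A)\to X_2$ such that $\begin{pmatrix}F&E_2\\ E_3&0\end{pmatrix}:l_2(A)\oplus X_1\to l_2(A)\oplus X_2$ is invertible. *)

(* Defs.v *)
From HB Require Import structures.
From mathcomp Require Import all_boot all_order all_algebra.
From mathcomp Require Import complex.
From mathcomp Require Import boolp classical_sets functions reals topology.
From mathcomp Require Import normedtype sequences.

Set Implicit Arguments.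
Unset Strict Implicit.
Unset Printing Implicit Defensive.

Import Order.TTheory GRing.Theory Num.Theory.
Import numFieldNormedType.Exports.

Local Open Scope classical_set_scope.
Local Open Scope complex_scope.
Local Open Scope ring_scope.

(* Unital complex C*-algebras. The norm of a [normedModType] over [R[i]] is
   [R[i]]-valued (its values are real and nonnegative). The ring operations are
   fields of the mixin, and not inherited from [algType], because Hierarchy
   Builder does not allow a join of normed modules and rings above [numDomainType];
   the instance below makes [a * b] and [1] denote [cstar_mul a b] and
   [cstar_one]. The zero algebra is not excluded. *)
HB.mixin Record isCStarAlgebra (R : realType) A
    & CompleteNormedModule R[i] A := {
  cstar_one : A;
  cstar_mul : A -> A -> A;
  star : A -> A;
  cstar_mulA : associative cstar_mul;
  cstar_mul1 : left_id cstar_one cstar_mul;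
  cstar_mulr1 : right_id cstar_one cstar_mul;
  cstar_mulDl : left_distributive cstar_mul +%R;
  cstar_mulDr : right_distributive cstar_mul +%R;
  cstar_scalerAl : forall (k : R[i]) (a b : A),
    k *: cstar_mul a b = cstar_mul (k *: a) b;
  cstar_scalerAr : forall (k : R[i]) (a b : A),
    k *: cstar_mul a b = cstar_mul a (k *: b);
  starK : involutive star;
  starD : {morph star : a b / a + b};
  starZ : forall (k : R[i]) (a : A), star (k *: a) = (k^*)%C *: star a;
  starM : forall a b : A, star (cstar_mul a b) = cstar_mul (star b) (star a);
  cstar_normM : forall a b : A, `|cstar_mul a b| <= `|a| * `|b|;
  cstar_norm_star : forall a : A, `|cstar_mul a (star a)| = `|a| ^+ 2
}.
#[short(type="cstarAlgType")]
HB.structure Definition CStarAlgebra (R : realType) :=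
  {A of CompleteNormedModule R[i] A & isCStarAlgebra R A}.

HB.instance Definition _ (R : realType) (A : cstarAlgType R) :=
  GRing.Zmodule_isPzRing.Build (CStarAlgebra.sort A)
    (@cstar_mulA R A) (@cstar_mul1 R A) (@cstar_mulr1 R A)
    (@cstar_mulDl R A) (@cstar_mulDr R A).

(* A positive element of a C*-algebra is one of the form [b b^*]. *)
Definition cstar_pos (R : realType) (A : cstarAlgType R) (a : A) : Prop :=
  exists b : A, a = b * star b.

(* A left [A]-module with an [A]-valued product, given as a subset [hcar] of an
   ambient module [hvec] (only the vectors of [hcar] matter). In this way the
   space l_2(A), which is a set of sequences, its submodules, and abstract
   modules ([hcar] := setT) are all objects of the same kind. A map between
   such modules is a function between the ambient modules, and is only
   ever considered on [hcar]. *)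
Record hmod (R : realType) (A : cstarAlgType R) := Hmod {
  hvec :> lmodType A;
  hcar : set hvec;
  hip : hvec -> hvec -> A
}.

Section HilbertModules.
Context {R : realType} {A : cstarAlgType R}.
Implicit Types M N H X : hmod A.

Definition hnorm M (x : M) : R := Num.sqrt (complex.Re `|hip x x|).

Definition submodule M (S : set M) : Prop :=
  [/\ S `<=` @hcar R A M, S 0 &
      forall (a : A) (x y : M), S x -> S y -> S (a *: x + y)].

Definition hcomplete M : Prop :=
  forall u : nat -> M, (forall n, hcar (u n)) ->
    (forall e : R, 0 < e -> exists N : nat, forall m n : nat,
       (N <= m)%N -> (N <= n)%N -> hnorm (u m - u n) < e) ->
    exists2 l : M, hcar l & (fun n => hnorm (u n - l)) @ \oo --> (0 : R).

Record hilbert_module M : Prop := HilbertModule {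
  hilbert_submodule : submodule (@hcar R A M);
  hilbert_linear : forall (a : A) (x y z : M), hcar x -> hcar y -> hcar z ->
    hip (a *: x + y) z = a * hip x z + hip y z;
  hilbert_herm : forall x y : M, hcar x -> hcar y -> star (hip x y) = hip y x;
  hilbert_pos : forall x : M, hcar x -> cstar_pos (hip x x);
  hilbert_def : forall x : M, hcar x -> hip x x = 0 -> x = 0;
  hilbert_complete : hcomplete M
}.

Definition fin_generated M : Prop :=
  exists (n : nat) (g : 'I_n -> M), (forall i, hcar (g i)) /\
    forall x : M, hcar x -> exists a : 'I_n -> A, x = \sum_(i < n) a i *: g i.

Definition fg_hilbert M : Prop := hilbert_module M /\ fin_generated M.

(* Bounded [A]-operators; no adjoint is assumed. *)
Definition bounded_op M N (T : M -> N) : Prop :=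
  [/\ forall x, hcar x -> hcar (T x),
      forall (a : A) (x y : M), hcar x -> hcar y ->
        T (a *: x + y) = a *: T x + T y &
      exists c : R, forall x, hcar x -> hnorm (T x) <= c * hnorm x].

Definition opnorm M N (T : M -> N) : R :=
  inf [set c : R | 0 <= c /\ forall x, hcar x -> hnorm (T x) <= c * hnorm x].

Definition invertible_op M N (T : M -> N) : Prop :=
  bounded_op T /\ exists S : N -> M,
    [/\ bounded_op S, forall x, hcar x -> S (T x) = x &
        forall y, hcar y -> T (S y) = y].

Definition fg_op H (T : H -> H) : Prop :=
  bounded_op T /\
  exists (M : hmod A) (f1 : H -> M) (f2 : M -> H),
    [/\ fg_hilbert M, bounded_op f1, bounded_op f2 &
        forall x, hcar x -> T x = f2 (f1 x)].

Definition compact_op H (K : H -> H) : Prop :=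
  bounded_op K /\
  forall e : R, 0 < e ->
    exists2 T : H -> H, fg_op T & opnorm (fun x => K x - T x) < e.

Definition fredholm_op H (F : H -> H) : Prop :=
  bounded_op F /\
  exists G : H -> H,
    [/\ bounded_op G, compact_op (fun x => x - F (G x)) &
        compact_op (fun x => x - G (F x))].

Definition hsub M (S : set M) : hmod A := @Hmod R A M S (@hip R A M).

Definition hsum M N : hmod A :=
  @Hmod R A (hvec M * hvec N)%type
    [set p | hcar p.1 /\ hcar p.2]
    (fun p q => hip p.1 q.1 + hip p.2 q.2).

Definition closed_submodule M (S : set M) : Prop :=
  submodule S /\
  forall x : M, hcar x ->
    (forall e : R, 0 < e -> exists2 y, S y & hnorm (x - y) < e) -> S x.

(* [M] is the internal, not necessarily orthogonal, direct sum of [S] and [T]. *)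
Definition direct_decomposition M (S T : set M) : Prop :=
  [/\ closed_submodule S, closed_submodule T, S `&` T = [set 0] &
      forall x : M, hcar x -> exists s t : M, [/\ S s, T t & x = s + t]].

Definition inner_noether H (F : H -> H) : Prop :=
  exists M1 N1 M2 N2 : set H,
    [/\ direct_decomposition M1 N1, direct_decomposition M2 N2,
        fg_hilbert (hsub N1), fg_hilbert (hsub N2) &
        exists (F1 : hsub M1 -> hsub M2) (F2 : hsub N1 -> hsub M2)
               (F4 : hsub N1 -> hsub N2),
          [/\ invertible_op F1, bounded_op F2, bounded_op F4 &
              forall x u : H, M1 x -> N1 u ->
                F (x + u) = (F1 x + F2 u) + (0 + F4 u)]].

Definition external_noether H (F : H -> H) : Prop :=
  exists (X1 X2 : hmod A) (E2 : X1 -> H) (E3 : H -> X2),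
    [/\ fg_hilbert X1, fg_hilbert X2, bounded_op E2, bounded_op E3 &
        @invertible_op (hsum H X1) (hsum H X2)
          (fun p => (F p.1 + E2 p.2, E3 p.1 + 0))].

End HilbertModules.

(* The left module structure on sequences is the pointwise one, [A^o] being [A]
   as a left module over itself. The limits are norm limits in [A]; the series
   defining [hip x y] converges whenever [x] and [y] belong to l_2(A). *)
Definition l2 (R : realType) (A : cstarAlgType R) : hmod A :=
  @Hmod R A (nat -> A^o)
    [set x : nat -> A^o |
      cvgn (fun n => \sum_(k < n) (x k : A) * star (x k : A) : A)]
    (fun x y : nat -> A^o =>
      limn (fun n => \sum_(k < n) (x k : A) * star (y k : A) : A)).

(* Main.v *)
Require Import Defs.
From mathcomp Require Import all_boot all_order all_algebra complex.
From mathcomp Require Import boolp classical_sets functions reals topology.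
From mathcomp Require Import normedtype sequences.
From mathcomp Require Import ring lra.

(* Let [F G = 1 - K] and [G F = 1 - K'] with [K], [K'] compact, and let [q] be the
   truncation [trunc n], which kills the first [n] coordinates. As [K] is a limit
   of operators that factor through finitely generated modules, [q K] is small
   for large [n]: by Baire's theorem the elements of the unit ball of such a
   module are combinations of the generators with uniformly bounded
   coefficients, so smallness on the generators suffices. Hence [1 - q K] is
   invertible, and [S = G (1 - q K)^-1 q] satisfies [q F S = q] and [S q = S].
   Then [S F] and [F S] are idempotents, and [F] is diagonal for the
   decompositions [Im (S F) + Ker (q F)] and [Im (F S) + Ker q], with inverse [S]
   between the first summands. [Ker q] is free of rank [n]; on [Ker (q F)] the
   identity is [G F + K'], where [F] has values in [Ker q], so it is compact, which
   makes [Ker (q F)] finitely generated. Bordering [F] by the inclusion of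
   [Ker q] and the projection onto [Ker (q F)] makes it invertible.

   No spectral theory is available: the positivity of [a a^*] and the closedness
   of the positive cone are derived from a square root of [1 - b], [|b| <= 1],
   obtained by iteration. *)

Set Implicit Arguments.
Unset Strict Implicit.
Unset Printing Implicit Defensive.

Import Order.TTheory GRing.Theory Num.Theory.
Import numFieldNormedType.Exports.

Local Open Scope classical_set_scope.
Local Open Scope complex_scope.
Local Open Scope ring_scope.

(** * Norm of a C*-algebra *)

Section Norm.
Context {R : realType} {A : cstarAlgType R}.
Implicit Types (a b : A) (t : R).

Definition nrm a : R := complex.Re `|a|.

Lemma nrmE a : `|a| = (nrm a)%:C.
Proof. by rewrite /nrm RRe_real // normr_real. Qed.

Lemma nrm_ge0 a : 0 <= nrm a.
Proof. by rewrite -lecR -nrmE; exact: normr_ge0. Qed.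

Lemma nrm0 : nrm (0 : A) = 0.
Proof. by rewrite /nrm normr0. Qed.

Lemma nrm_eq0 a : nrm a = 0 -> a = 0.
Proof. by move=> a0; apply/normr0_eq0; rewrite nrmE a0. Qed.

Lemma nrmN a : nrm (- a) = nrm a.
Proof. by rewrite /nrm normrN. Qed.

Lemma nrmB a b : nrm (a - b) = nrm (b - a).
Proof. by rewrite -nrmN opprB. Qed.

Lemma ler_nrmD a b : nrm (a + b) <= nrm a + nrm b.
Proof. by rewrite -lecR rmorphD /= -!nrmE ler_normD. Qed.

Lemma ler_nrmB a b : nrm (a - b) <= nrm a + nrm b.
Proof. by rewrite -(nrmN b) ler_nrmD. Qed.

Lemma ler_nrmM a b : nrm (a * b) <= nrm a * nrm b.
Proof. by rewrite -lecR rmorphM /= -!nrmE; exact: cstar_normM. Qed.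

Lemma nrmZ t a : nrm (t%:C *: a) = `|t| * nrm a.
Proof.
apply: complexI; rewrite rmorphM /= -!nrmE normrZ; congr (_ * _).
by rewrite normc_def /= expr0n addr0 sqrtr_sqr.
Qed.

Lemma nrmMstar a : nrm (a * star a) = nrm a ^+ 2.
Proof.
by apply: complexI; rewrite rmorphXn /= -!nrmE; exact: cstar_norm_star.
Qed.

(** The C*-identity and submultiplicativity give [|b|^2 <= |b| |b^*|], where one factor [|b|]
    cancels; applying this to [star b] gives the converse. *)
Lemma nrm_star a : nrm (star a) = nrm a.
Proof.
suff le b : nrm b <= nrm (star b).
  by apply: le_anti; rewrite le -{2}(starK a) le.
have := ler_nrmM b (star b); rewrite nrmMstar expr2.
have [->|b0] := eqVneq (nrm b) 0; first by rewrite nrm_ge0.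
by rewrite ler_pM2l // lt_neqAle eq_sym b0 nrm_ge0.
Qed.

Lemma nrmstarM a : nrm (star a * a) = nrm a ^+ 2.
Proof. by rewrite -{2}(starK a) nrmMstar nrm_star. Qed.

Lemma star_sum (I : Type) (r : seq I) (P : pred I) (f : I -> A) :
  star (\sum_(i <- r | P i) f i) = \sum_(i <- r | P i) star (f i).
Proof.
apply: (big_morph _ (@starD R A)).
by apply: (addrI (star 0)); rewrite -starD !addr0.
Qed.

Lemma star0 : star 0 = 0 :> A.
Proof. by apply: (addrI (star 0)); rewrite -starD !addr0. Qed.

Lemma starN a : star (- a) = - star a.
Proof. by apply: (addrI (star a)); rewrite -starD !subrr star0. Qed.

Lemma starB a b : star (a - b) = star a - star b.
Proof. by rewrite starD starN. Qed.

Lemma starZr t a : star (t%:C *: a) = t%:C *: star a.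
Proof. by rewrite starZ conjc_real. Qed.

Lemma star_mul a b : star (a * b) = star b * star a.
Proof. exact: starM. Qed.

Lemma star1 : star 1 = 1 :> A.
Proof. by rewrite -[LHS]mulr1 -{2}(starK 1) -star_mul mulr1 starK. Qed.

(** Only an inequality, since the zero algebra is allowed: [|1|^2 = |1|] leaves the two values 0 and
    1. *)
Lemma nrm1 : nrm (1 : A) <= 1.
Proof.
have := nrmMstar 1; rewrite star1 mulr1 => e.
have [->|n0] := eqVneq (nrm (1 : A)) 0; first by rewrite ler01.
have : nrm (1 : A) * nrm (1 : A) <= nrm (1 : A) * 1 by rewrite -expr2 -e mulr1.
by rewrite ler_pM2l // lt_neqAle eq_sym n0 nrm_ge0.
Qed.

Lemma cscalerAl (k : R[i]) a b : (k *: a) * b = k *: (a * b).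
Proof. by rewrite [RHS]cstar_scalerAl. Qed.

Lemma cscalerAr (k : R[i]) a b : a * (k *: b) = k *: (a * b).
Proof. by rewrite [RHS]cstar_scalerAr. Qed.

Lemma nrm_alg t : 0 <= t -> nrm (t%:C *: (1 : A)) <= t.
Proof.
by move=> t0; rewrite nrmZ ger0_norm // -{2}[t]mulr1 ler_wpM2l ?nrm1.
Qed.

(** A positive element of [R[i]] is real, so convergence may be tested with [e] in [R]; all later
    estimates stay in this ordered field. *)
Lemma nrm_cvgP (u : nat -> A) (l : A) : u @ \oo --> l <->
  forall e : R, 0 < e -> exists N : nat, forall n,
    (N <= n)%N -> nrm (u n - l) < e.
Proof.
rewrite cvgrPdist_lt; split=> [ul e e0|ul e e0].
  have [|N _ HN] := ul e%:C; first by rewrite ltcR.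
  by exists N => n /HN /=; rewrite nrmE ltcR nrmB.
have er : e = (complex.Re e)%:C by rewrite RRe_real // gtr0_real.
rewrite er ltcR in e0; have [N HN] := ul _ e0.
by exists N => // n /= /HN; rewrite er nrmE ltcR nrmB.
Qed.

Lemma nrm_cauchy_cvg (u : nat -> A) :
  (forall e : R, 0 < e -> exists N : nat, forall m n,
     (N <= m)%N -> (N <= n)%N -> nrm (u m - u n) < e) -> cvgn u.
Proof.
move=> cu; apply: cauchy_cvg; apply: cauchy_exP => e e0.
have er : e = (complex.Re e)%:C by rewrite RRe_real // gtr0_real.
rewrite er ltcR in e0; have [N HN] := cu _ e0.
exists (u N); exists N => // n /= Nn.
by rewrite er -ball_normE /= nrmE ltcR HN.
Qed.

Lemma nrm_cvg_cauchy (u : nat -> A) : cvgn u ->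
  forall e : R, 0 < e -> exists N : nat, forall m n,
     (N <= m)%N -> (N <= n)%N -> nrm (u m - u n) < e.
Proof.
move=> /nrm_cvgP cu e e0; have [|N HN] := cu (e / 2); first by rewrite divr_gt0.
exists N => m n Nm Nn; rewrite -[u m](subrK (limn u)) -addrA.
apply: le_lt_trans (ler_nrmD _ _) _; rewrite [e]splitr ltrD ?HN //.
by rewrite nrmB HN.
Qed.

End Norm.

(** * Square roots and positivity *)

Section SquareRoot.
Context {R : realType} {A : cstarAlgType R}.
Implicit Types (a b c : A) (t : R).
Local Notation sc t := (t%:C *: (1 : A)).
Local Notation half := (2^-1)%:C.

Lemma nrm_arbitrarily_small t a :
  (forall e, 0 < e -> nrm a <= t * e) -> a = 0.
Proof.
move=> small; apply: nrm_eq0; apply/eqP; rewrite eq_le nrm_ge0 andbT.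
have [t0|t0] := leP t 0.
  by apply: le_trans (small 1 ltr01) _; rewrite mulr1.
apply/ler_addgt0Pr => e e0; rewrite add0r.
have := small (e / t) (divr_gt0 e0 t0).
by rewrite mulrCA divff ?mulr1 // gt_eqF.
Qed.

Lemma halfD a : half *: a + half *: a = a.
Proof.
rewrite -scalerDl -rmorphD /= -[RHS]scale1r; congr (_ *: _).
by congr (_ %:C); rewrite [RHS]splitr mul1r.
Qed.

(** A fixed point [y] of this recursion satisfies [2 y = b + y^2], that is [(1 - y)^2 = 1 - b]. *)
Fixpoint sqrt_iter b n : A :=
  if n is m.+1 then half *: (b + sqrt_iter b m * sqrt_iter b m) else 0.

(* The iteration of [sqrt_iter] in the scalars with [b = 1]: it dominates the
   other one, and converges, as long as [nrm b <= 1], the case of equality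
   included. *)
Fixpoint sqrt_majorant n : R :=
  if n is m.+1 then 2^-1 * (1 + sqrt_majorant m * sqrt_majorant m) else 0.

Lemma sqrt_majorant_bound n : 0 <= sqrt_majorant n <= 1.
Proof.
elim: n => [|n /andP[q0 q1]] /=; first by rewrite lexx ler01.
by apply/andP; split; nra.
Qed.

Lemma sqrt_majorantS n : sqrt_majorant n <= sqrt_majorant n.+1.
(* The increment is [(sqrt_majorant n - 1)^2 / 2]. *)
Proof. by have := sqr_ge0 (sqrt_majorant n - 1); rewrite /= expr2; nra. Qed.

Lemma sqrt_majorant_homo : {homo sqrt_majorant : m n / (m <= n)%N >-> m <= n}.
Proof.
by apply: homo_leq => [//|? ? ?|]; [exact: le_trans|exact: sqrt_majorantS].
Qed.

Lemma sqrt_majorant_cauchy e : 0 < e -> exists N : nat, forall n,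
  (N <= n)%N -> sqrt_majorant n - sqrt_majorant N < e.
Proof.
move=> e0; have cv : cvgn sqrt_majorant.
  apply: nondecreasing_is_cvgn; first exact: sqrt_majorant_homo.
  by exists 1 => _ [n _ <-]; case/andP: (sqrt_majorant_bound n).
have /cvgrPdist_lt/(_ (e / 2))[|N _ HN] := cv; first by rewrite divr_gt0.
exists N => n Nn.
have /= := HN N (leqnn N); have /= := HN n Nn.
by rewrite !ltr_norml => /andP[? ?] /andP[? ?]; lra.
Qed.

Lemma sqrt_iter_comm b c n : GRing.comm c b -> GRing.comm c (sqrt_iter b n).
Proof.
move=> cb; elim: n => [|n IH] /=; first exact: commr0.
by rewrite /GRing.comm cscalerAr cscalerAl; congr (_ *: _);
  apply: commrD => //; apply: commrM.
Qed.

Lemma sqrt_iter_star b n : star b = b -> star (sqrt_iter b n) = sqrt_iter b n.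
Proof.
move=> sb; elim: n => [|n IH] /=; first exact: star0.
by rewrite starZr starD star_mul IH sb.
Qed.

Lemma sqrt_iter_bound b n : nrm b <= 1 ->
  nrm (sqrt_iter b n) <= sqrt_majorant n.
Proof.
move=> b1; elim: n => [|n IH] /=; first by rewrite nrm0.
rewrite nrmZ ger0_norm ?invr_ge0 // ler_pM2l ?invr_gt0 //.
apply: le_trans (ler_nrmD _ _) (lerD b1 _).
apply: le_trans (ler_nrmM _ _) _.
by apply: ler_pM => //; exact: nrm_ge0.
Qed.

(** Iterates commute, so a difference of squares factors as [(x - y) (x + y)]; the difference for
    the majorant factors in the same way and dominates factor by factor. *)
Lemma sqrt_iter_dist b m k : nrm b <= 1 ->
  nrm (sqrt_iter b (m + k) - sqrt_iter b m) <=
    sqrt_majorant (m + k) - sqrt_majorant m.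
Proof.
move=> b1; elim: m => [|m IH]; first by rewrite add0n !subr0 sqrt_iter_bound.
rewrite addSn /= -scalerBr -mulrBr (opprD b) addrACA subrr add0r.
rewrite (opprD 1) addrACA subrr add0r.
set x := sqrt_iter b (m + k) in IH *; set y := sqrt_iter b m in IH *.
set p := sqrt_majorant _ in IH *; set q := sqrt_majorant m in IH *.
have xp : nrm x <= p by exact: sqrt_iter_bound.
have yq : nrm y <= q by exact: sqrt_iter_bound.
have xy : GRing.comm x y by apply/sqrt_iter_comm/commr_sym/sqrt_iter_comm.
have -> : x * x - y * y = (x - y) * (x + y).
  by rewrite mulrDr !mulrBl xy addrA subrK.
rewrite nrmZ ger0_norm ?invr_ge0 // ler_pM2l ?invr_gt0 //.
have -> : p * p - q * q = (p - q) * (p + q) by ring.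
apply: le_trans (ler_nrmM _ _) _; apply: ler_pM; rewrite ?nrm_ge0 //.
exact: le_trans (ler_nrmD _ _) (lerD xp yq).
Qed.

(* [1 - y] is the square root of [1 - b]. *)
Lemma sqrt_fixpoint b : star b = b -> nrm b <= 1 ->
  exists y : A, [/\ star y = y, nrm y <= 1, y + y = b + y * y &
    forall c, GRing.comm c b -> GRing.comm c y].
Proof.
move=> sb b1.
have cau : forall e : R, 0 < e -> exists N : nat, forall n,
    (N <= n)%N -> nrm (sqrt_iter b n - sqrt_iter b N) < e.
  move=> e /sqrt_majorant_cauchy[N HN]; exists N => n Nn.
  rewrite -(subnKC Nn); apply: le_lt_trans (sqrt_iter_dist _ _ b1) _.
  by rewrite subnKC // HN.
have : cvgn (sqrt_iter b).
  apply: nrm_cauchy_cvg => e e0; have [|N HN] := cau (e / 2).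
    by rewrite divr_gt0.
  exists N => m n Nm Nn; rewrite -[sqrt_iter b m](subrK (sqrt_iter b N)) -addrA.
  apply: le_lt_trans (ler_nrmD _ _) _; rewrite [e]splitr ltrD ?HN //.
  by rewrite nrmB HN.
move=> /nrm_cvgP; set y := limn _ => cvy.
(* Two consecutive iterates are needed near [y], because the fixed point equation is the limit of
   the recursion that links them. *)
have near e : 0 < e -> exists n, nrm (y - sqrt_iter b n) <= e /\
    nrm (y - sqrt_iter b n.+1) <= e.
  move=> /cvy[N HN]; exists N.
  by rewrite ![nrm (y - _)]nrmB !ltW ?HN.
have iter1 n : nrm (sqrt_iter b n) <= 1.
  apply: le_trans (sqrt_iter_bound _ b1) _.
  by case/andP: (sqrt_majorant_bound n).
have y1 : nrm y <= 1.
  apply/ler_addgt0Pr => e /near[n [ne _]].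
  rewrite -[y](subrK (sqrt_iter b n)) addrC (le_trans (ler_nrmD _ _)) //.
  exact: lerD.
exists y; split => //.
- apply/subr0_eq/(@nrm_arbitrarily_small 2) => e /near[n [ne _]].
  have -> : star y - y = star (y - sqrt_iter b n) - (y - sqrt_iter b n).
    by rewrite starB sqrt_iter_star // opprB subrKA.
  by apply: le_trans (ler_nrmB _ _) _; rewrite nrm_star; lra.
- apply/subr0_eq/(@nrm_arbitrarily_small 4) => e /near[n [ne ne1]].
  set z := sqrt_iter b n in ne.
  have ez : sqrt_iter b n.+1 + sqrt_iter b n.+1 = b + z * z by rewrite /= halfD.
  set w := sqrt_iter b n.+1 in ez ne1.
  (* Subtracting the recursion [w + w = b + z z] leaves four terms with a small factor each; since
     [|y|] and [|z|] are at most 1, they add up to at most [4 e]. *)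
  have -> : y + y - (b + y * y) =
      ((y - w) + (y - w)) - ((y - z) * y + z * (y - z)).
    rewrite mulrBl mulrBr subrKA [(y - w) + _]addrACA -opprD ez opprB.
    by rewrite -[RHS]addrA (opprD b (z * z)) subrKA -opprD.
  apply: le_trans (ler_nrmB _ _) _.
  have h1 := ler_nrmD (y - w) (y - w).
  have h2 := ler_nrmD ((y - z) * y) (z * (y - z)).
  have h3 : nrm ((y - z) * y) <= e.
    apply: le_trans (ler_nrmM _ _) _; rewrite -[e]mulr1.
    by apply: ler_pM; rewrite ?nrm_ge0.
  have h4 : nrm (z * (y - z)) <= e.
    apply: le_trans (ler_nrmM _ _) _; rewrite -[e]mul1r.
    by apply: ler_pM; rewrite ?nrm_ge0 ?iter1.
  lra.
- move=> c cb; apply/subr0_eq/(@nrm_arbitrarily_small (2 * nrm c)).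
  move=> e /near[n [ne _]].
  have -> : c * y - y * c = c * (y - sqrt_iter b n) - (y - sqrt_iter b n) * c.
    by rewrite mulrBr mulrBl (sqrt_iter_comm n cb) opprB subrKA.
  apply: le_trans (ler_nrmB _ _) _.
  have h1 := ler_nrmM c (y - sqrt_iter b n).
  have h2 := ler_nrmM (y - sqrt_iter b n) c.
  have := ler_wpM2l (nrm_ge0 c) ne; lra.
Qed.
End SquareRoot.

(** * Positive elements and the cone they form *)

Section Positive.
Context {R : realType} {A : cstarAlgType R}.
Implicit Types (a b c d s r y : A) (t : R).
Local Notation sc t := (t%:C *: (1 : A)).
Local Notation half := ((2^-1)%:C).
Local Notation I := (Complex 0 1 : R[i]).

Lemma sqrI : I * I = -1.
Proof. by rewrite -expr2 sqr_i. Qed.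

Lemma conjI : (I^*)%C = - I.
Proof. by apply/eqP; rewrite eq_complex /= oppr0 !eqxx. Qed.

(* The usual spectral characterisation of [0 <= a] without the spectrum; it is
   [cstar_pos] by [sposP]. *)
Definition spos a : Prop :=
  star a = a /\ exists2 t, 0 <= t & nrm (sc t - a) <= t.

Lemma star_sc t : star (sc t) = sc t.
Proof. by rewrite starZr star1. Qed.

Lemma comm_sc c t : GRing.comm c (sc t).
Proof. by rewrite /GRing.comm cscalerAl cscalerAr mulr1 mul1r. Qed.

(** For [t > 0], the element [b = (t - a) / t] has norm at most 1 and [1 - b = a / t], so the root
    is [sqrt t (1 - y)] with [y] from [sqrt_fixpoint]. *)
Lemma spos_sqrt a : spos a -> exists s : A, [/\ spos s, s * s = a &
  forall c, GRing.comm c a -> GRing.comm c s].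
Proof.
move=> [sa [t]]; rewrite le_eqVlt => /predU1P[<-|t0] ta.
  have -> : a = 0.
    apply: nrm_eq0; apply/eqP; rewrite eq_le nrm_ge0 andbT -nrmN.
    by rewrite scale0r add0r in ta.
  exists 0; split; rewrite ?mulr0 //; split; first exact: star0.
  by exists 0; rewrite ?subr0 ?nrmZ ?normr0 ?mul0r.
pose b := (t^-1)%:C *: (sc t - a).
have eb : b = 1 - (t^-1)%:C *: a.
  by rewrite /b scalerBr scalerA -rmorphM /= mulVf ?gt_eqF ?scale1r.
have [||y [sy y1 yy ycomm]] := @sqrt_fixpoint R A b.
- by rewrite starZr starB star_sc sa.
- rewrite nrmZ ger0_norm ?invr_ge0 ?(ltW t0) //.
  by rewrite mulrC ler_pdivrMr // mul1r.
exists ((Num.sqrt t)%:C *: (1 - y)); split.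
- split; first by rewrite starZr starB star1 sy.
  exists (Num.sqrt t); first exact: sqrtr_ge0.
  rewrite -scalerBr opprB addrC subrK nrmZ ger0_norm ?sqrtr_ge0 //.
  by rewrite -[leRHS]mulr1 ler_wpM2l ?sqrtr_ge0.
- rewrite cscalerAl cscalerAr scalerA -rmorphM /= -expr2 sqr_sqrtr ?(ltW t0) //.
  have -> : (1 - y) * (1 - y) = 1 - b.
    have -> : b = y + y - y * y by rewrite yy addrK.
    by rewrite mulrBl mul1r mulrBr mulr1 !opprB -addrA [- y + _]addrCA -opprD.
  rewrite eb opprB addrC subrK scalerA -rmorphM /=.
  by rewrite mulfV ?gt_eqF ?scale1r.
- move=> c ca; have cb : GRing.comm c b.
    rewrite eb; apply: commrB; first exact: commr1.
    by rewrite /GRing.comm cscalerAr cscalerAl ca.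
  by rewrite /GRing.comm cscalerAr cscalerAl; congr (_ *: _);
    apply: commrB; [exact: commr1|exact: ycomm].
Qed.

(* [s] and [r] are the real and imaginary parts of the normal [s + i r]. *)
Lemma nrm_sqr_le s r : star s = s -> star r = r -> GRing.comm s r ->
  nrm s ^+ 2 <= nrm (s * s + r * r).
Proof.
move=> ss sr sr_comm; pose u := s + I *: r.
have su : star u = s - I *: r.
  by rewrite starD ss starZ sr conjI scaleNr.
have -> : s * s + r * r = u * star u.
  rewrite su /u mulrDl !mulrBr !cscalerAl !cscalerAr scalerA sqrI.
  by rewrite scaleN1r opprK sr_comm subrKA.
rewrite nrmMstar; apply: lerXn2r; rewrite ?nnegrE ?nrm_ge0 //.
have -> : s = half *: (u + star u).
  by rewrite su /u addrACA subrr addr0 scalerDr halfD.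
rewrite nrmZ ger0_norm ?invr_ge0 // mulrC ler_pdivrMr //.
by apply: le_trans (ler_nrmD _ _) _; rewrite nrm_star; lra.
Qed.

Lemma spos_sub t a : star a = a -> nrm a <= t -> spos (sc t - a).
Proof.
move=> sa at_; split; first by rewrite starB star_sc sa.
exists t; first exact: le_trans (nrm_ge0 a) at_.
by rewrite opprB addrC subrK.
Qed.

Lemma sposD a b : spos a -> spos b -> spos (a + b).
Proof.
move=> [sa [t t0 ta]] [sb [u u0 ub]]; split; first by rewrite starD sa sb.
exists (t + u); first exact: addr_ge0.
rewrite rmorphD /= scalerDl opprD addrACA.
exact: le_trans (ler_nrmD _ _) (lerD ta ub).
Qed.

Lemma sposZ t a : 0 <= t -> spos a -> spos (t%:C *: a).
Proof.
move=> t0 [sa [u u0 ua]]; split; first by rewrite starZr sa.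
exists (t * u); first exact: mulr_ge0.
by rewrite rmorphM /= -scalerA -scalerBr nrmZ ger0_norm // ler_wpM2l.
Qed.

Lemma spos0 : spos 0.
Proof. by split; [exact: star0|exists 0; rewrite // subr0 scale0r nrm0]. Qed.

(** With [t = |a|^2] and [s] the root of [t - a^2], which commutes with [a], one has
    [|t - a^2| <= |s|^2 <= |s^2 + a^2| <= t]. *)
Lemma spos_sqr a : star a = a -> spos (a * a).
Proof.
move=> sa; split; first by rewrite star_mul sa.
set t := nrm a ^+ 2; have t0 : 0 <= t by rewrite sqr_ge0.
exists t => //.
have [|s [[ss _] ss_eq scomm]] := @spos_sqrt (sc t - a * a).
  by apply: spos_sub; rewrite ?star_mul ?sa // -{2}sa nrmMstar.
have sa_comm : GRing.comm a s.
  apply: scomm; apply: commrB; first exact: comm_sc.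
  by apply: commrM.
rewrite -ss_eq; apply: le_trans (ler_nrmM _ _) _; rewrite -expr2.
apply: le_trans (@nrm_sqr_le s a ss sa (commr_sym sa_comm)) _.
by rewrite ss_eq subrK nrm_alg.
Qed.

(** If [a = s^2] and [t - a = r^2], the roots commute and [|a| <= |s|^2 <= |s^2 + r^2| <= t]. *)
Lemma spos_le t a : 0 <= t -> spos a -> spos (sc t - a) -> nrm a <= t.
Proof.
move=> t0 /spos_sqrt[s [[ss _] <- scomm]] /spos_sqrt[r [[sr _] er rcomm]].
have sr_comm : GRing.comm s r.
  apply: rcomm; apply: commrB; first exact: comm_sc.
  by apply: commrM.
apply: le_trans (ler_nrmM _ _) _; rewrite -expr2.
apply: le_trans (@nrm_sqr_le s r ss sr sr_comm) _.
by rewrite er addrC subrK nrm_alg.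
Qed.

(** [|b| - a] is the sum of the positive elements [|b| - b] and [b - a], so [spos_le] applies. *)
Lemma spos_nrm_le a b : spos a -> spos (b - a) -> nrm a <= nrm b.
Proof.
move=> pa pba; apply: spos_le => //; first exact: nrm_ge0.
rewrite -(subrK b (sc _)) -addrA; apply: sposD => //; apply: spos_sub => //.
by rewrite -(subrK a b) starD; case: pa => -> _; case: pba => -> _.
Qed.

(* With [c = y^* y], [d = - y y^*] and [N = |y|^2], both [c] and [d] are positive
   and [y (N + c) = (N - d) y]. The right side has norm at most [N |y|], while
   the square of the norm of the left side is at least [|2 N c^2| = 2 N^3]. *)
Lemma spos_opp_mulstar y : spos (- (y * star y)) -> y = 0.
Proof.
set d := - (y * star y) => pd; set c := star y * y.
set N := nrm y ^+ 2; have N0 : 0 <= N by exact: sqr_ge0.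
have nd : nrm d = N by rewrite nrmN nrmMstar.
have nc : nrm c = N by rewrite nrmstarM.
have sc_ : star c = c by rewrite star_mul starK.
have pc : spos c.
  have -> : c = half *: ((y + star y) * (y + star y) +
      (I *: (y - star y)) * (I *: (y - star y))) + d.
    rewrite cscalerAl cscalerAr scalerA sqrI scaleN1r.
    have -> : (y + star y) * (y + star y) - (y - star y) * (y - star y) =
        (c + y * star y) + (c + y * star y).
      rewrite mulrBl !mulrBr mulrDl !mulrDr [X in X + _ - _]addrC.
      rewrite [X in X - _]addrACA !opprB.
      rewrite [X in _ + X]addrACA -opprD [star y * star y + _]addrC.
      rewrite [LHS]addrACA.
      by rewrite subrr addr0 [y * star y + _]addrC.
    by rewrite scalerDr halfD addrK.
  apply: sposD => //; apply: sposZ; first by rewrite invr_ge0.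
  apply: sposD; apply: spos_sqr; first by rewrite starD starK addrC.
  by rewrite starZ starB starK conjI scaleNr -scalerN opprB.
have [s [[ss _] es scomm]] := spos_sqrt pc.
pose z := y * (sc N + c).
have ez : z = (sc N - d) * y.
  by rewrite /z mulrDr mulrBl (comm_sc y N) mulNr opprK mulrA.
have zle : nrm z <= N * nrm y.
  rewrite ez; apply: le_trans (ler_nrmM _ _) _; rewrite ler_wpM2r ?nrm_ge0 //.
  (* Both [N - d] and [N - (N - d) = d] are positive. *)
  apply: spos_le => //; first by rewrite -nd; apply: spos_sub => //; case: pd.
  by rewrite opprB addrC subrK.
have zge : 2 * N * N ^+ 2 <= nrm z ^+ 2.
  rewrite -nrmstarM.
  (* This expands [(N + c) c (N + c)], with [c^3] written as the square [(c s)^2] to make its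
     positivity visible. *)
  have -> : star z * z = (2 * N)%:C *: (c * c) +
      ((N ^+ 2)%:C *: c + (c * s) * (c * s)).
    have cs : GRing.comm c s by apply: scomm.
    have -> : (c * s) * (c * s) = c * c * c.
      by rewrite mulrA -[c * s * c]mulrA -cs mulrA -mulrA es.
    rewrite star_mul starD star_sc sc_ mulrA -[_ * star y * y]mulrA -/c.
    rewrite [(sc N + c) * c]mulrDl cscalerAl mul1r mulrDr !cscalerAr mulr1.
    rewrite scalerDr scalerA -rmorphM /= -expr2 mulrDl cscalerAl.
    rewrite -addrA [RHS]addrCA; congr (_ + _).
    by rewrite addrA -scalerDl -rmorphD /= mulr_natl mulr2n.
  have <- : nrm ((2 * N)%:C *: (c * c)) = 2 * N * N ^+ 2.
    by rewrite nrmZ -[X in nrm (_ * X)]sc_ nrmMstar nc ger0_norm // mulr_ge0.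
  apply: spos_nrm_le.
    by apply: sposZ; [rewrite mulr_ge0|exact: spos_sqr].
  rewrite [X in X - _]addrC addrK; apply: sposD.
    by apply: sposZ; rewrite ?sqr_ge0.
  apply: spos_sqr; rewrite star_mul ss sc_; apply/esym/scomm.
  by [].
have : nrm z ^+ 2 <= N ^+ 3.
  have -> : N ^+ 3 = (N * nrm y) ^+ 2 by rewrite /N; ring.
  by rewrite lerXn2r // nnegrE ?nrm_ge0 // mulr_ge0 ?nrm_ge0.
move=> h; apply: nrm_eq0; apply/eqP; rewrite -sqrf_eq0 -/N.
rewrite eq_le N0 andbT leNgt; apply/negP => /(exprn_gt0 3); lra.
Qed.

(* [m] is the absolute value of [c], and [f] is twice the negative part of [c],
   which satisfies [- (f a) (f a)^* = f m f >= 0]. *)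
Lemma spos_mulstar a : spos (a * star a).
Proof.
set c := a * star a; have sc_ : star c = c by rewrite star_mul starK.
have [m [pm em mcomm]] := spos_sqrt (spos_sqr sc_).
have cm : GRing.comm c m by apply/mcomm/commrM.
have [s [[ss _] es scomm]] := spos_sqrt pm.
have cs : GRing.comm c s by apply: scomm.
have ms : GRing.comm m s by apply: scomm.
pose f := m - c.
have sf : star f = f by rewrite starB sc_ pm.1.
have fs : GRing.comm f s by apply/commr_sym/commrB; apply: commr_sym.
have fm : GRing.comm f m.
  by apply/commr_sym/commrB; [|apply: commr_sym].
(* Since [m^2 = c^2], [(m - c) c = m c - m^2 = - (m - c) m]. *)
have fc : f * c = - (f * m) by rewrite !mulrBl em opprB cm.
have pfs : spos ((f * s) * (f * s)).
  by apply: spos_sqr; rewrite star_mul sf ss fs.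
have fsfs : (f * s) * (f * s) = f * m * f.
  by rewrite {2}fs mulrA -[f * s * s]mulrA es.
have fa0 : f * a = 0.
  apply: spos_opp_mulstar; rewrite star_mul sf mulrA -[f * a * _]mulrA -/c fc.
  by rewrite mulNr opprK -fsfs.
have fc0 : f * c = 0 by rewrite mulrA fa0 mul0r.
have fm0 : f * m = 0 by apply/oppr_inj; rewrite -fc fc0 oppr0.
have f0 : f = 0.
  apply: nrm_eq0; apply/eqP; rewrite -sqrf_eq0 -nrmMstar sf {2}/f.
  by rewrite mulrBr fm0 fc0 subr0 nrm0.
by rewrite -[c]add0r -f0 subrK.
Qed.

Lemma sposP a : cstar_pos a <-> spos a.
Proof.
split=> [[b ->]|pa]; first exact: spos_mulstar.
by have [s [[ss _] <- _]] := spos_sqrt pa; exists s; rewrite ss.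
Qed.

Lemma spos_conj a b : spos a -> spos (b * a * star b).
Proof.
move=> /spos_sqrt[s [[ss _] <- _]].
have -> : b * (s * s) * star b = (b * s) * star (b * s).
  by rewrite star_mul ss !mulrA.
exact: spos_mulstar.
Qed.

Lemma spos_sum (J : Type) (r : seq J) (P : pred J) (f : J -> A) :
  (forall j, P j -> spos (f j)) -> spos (\sum_(j <- r | P j) f j).
Proof. by move=> pf; elim/big_ind: _ => //; [exact: spos0|exact: sposD]. Qed.

(** The radius must not depend on the approximant: [t = |a| + 1] bounds the norm of every positive
    [b] with [|a - b| <= 1], so [|t - b| <= t], and the limit gives [|t - a| <= t]. *)
Lemma spos_closed a :
  (forall e, 0 < e -> exists2 b, spos b & nrm (a - b) <= e) -> spos a.
Proof.
move=> cl; split.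
  apply/subr0_eq/(@nrm_arbitrarily_small _ _ 2) => e /cl[b [sb _] ab].
  have -> : star a - a = star (a - b) - (a - b).
    by rewrite starB sb opprB subrKA.
  by apply: le_trans (ler_nrmB _ _) _; rewrite nrm_star; lra.
exists (nrm a + 1); first by rewrite addr_ge0 ?nrm_ge0.
apply/ler_addgt0Pr => e e0.
have [|b pb ab] := cl (Num.min e 1); first by rewrite lt_min e0 ltr01.
move: ab; rewrite le_min => /andP[abe ab1].
have bt : nrm b <= nrm a + 1.
  rewrite -[b](subrK a) addrC (le_trans (ler_nrmD _ _)) // lerD //.
  by rewrite nrmB.
rewrite -(subrKA b) (le_trans (ler_nrmD _ _)) // lerD //; last by rewrite nrmB.
apply: spos_le; first by rewrite addr_ge0 ?nrm_ge0.
  by apply: spos_sub => //; case: pb.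
by rewrite opprB addrC subrK.
Qed.
End Positive.

(** * Cauchy-Schwarz inequality *)

Section PreHilbert.
Context {R : realType} {A : cstarAlgType R}.
Local Notation sc t := ((t)%:C *: (1 : A)).

(* Also covers truncated inner products on sequences, which are degenerate. *)
Record prehilbert (M : hmod A) : Prop := PreHilbert {
  prehilbert_submodule : submodule (@hcar R A M);
  prehilbert_linear : forall (a : A) (x y z : M), hcar x -> hcar y -> hcar z ->
    hip (a *: x + y) z = a * hip x z + hip y z;
  prehilbert_herm : forall x y : M, hcar x -> hcar y ->
    star (hip x y) = hip y x;
  prehilbert_pos : forall x : M, hcar x -> spos (hip x x)
}.

Lemma hilbert_prehilbert (M : hmod A) : hilbert_module M -> prehilbert M.
Proof.
by case=> sM lM hM pM _ _; split=> // x Mx; apply/sposP; exact: pM.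
Qed.

Section Submodule.
Variables (M : hmod A) (S : set M).
Hypothesis sS : submodule S.

Lemma submodule0 : S 0.
Proof. by case: sS. Qed.

Lemma submoduleD x y : S x -> S y -> S (x + y).
Proof. by case: sS => _ _ lS Sx Sy; rewrite -[x]scale1r; exact: lS. Qed.

Lemma submoduleZ a x : S x -> S (a *: x).
Proof.
by case: sS => _ S0 lS Sx; rewrite -[a *: x]addr0; exact: lS.
Qed.

Lemma submoduleN x : S x -> S (- x).
Proof. by rewrite -scaleN1r; exact: submoduleZ. Qed.

Lemma submoduleB x y : S x -> S y -> S (x - y).
Proof. by move=> Sx Sy; apply: submoduleD => //; exact: submoduleN. Qed.

Lemma submodule_sum (J : Type) (r : seq J) (P : pred J) (f : J -> M) :
  (forall j, P j -> S (f j)) -> S (\sum_(j <- r | P j) f j).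
Proof.
move=> Sf; elim/big_ind: _ => //; [exact: submodule0|exact: submoduleD].
Qed.
End Submodule.

Section Theory.
Variable M : hmod A.
Hypothesis pM : prehilbert M.
Implicit Types (x y z : M) (a : A).
Let sM := prehilbert_submodule pM.

Lemma hipDl x y z : hcar x -> hcar y -> hcar z ->
  hip (x + y) z = hip x z + hip y z.
Proof.
move=> Mx My Mz; rewrite -[x in LHS]scale1r prehilbert_linear //.
by rewrite mul1r.
Qed.

Lemma hip0l z : hcar z -> hip 0 z = 0.
Proof.
move=> Mz; apply: (addrI (hip (0 : M) z)).
by rewrite -hipDl ?addr0 //; exact: submodule0.
Qed.

Lemma hipZl a x z : hcar x -> hcar z -> hip (a *: x) z = a * hip x z.
Proof.
move=> Mx Mz; rewrite -[a *: x]addr0 prehilbert_linear //.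
  by rewrite hip0l // addr0.
exact: submodule0.
Qed.

Lemma hipNl x z : hcar x -> hcar z -> hip (- x) z = - hip x z.
Proof. by move=> Mx Mz; rewrite -scaleN1r hipZl // mulN1r. Qed.

Lemma hipDr x y z : hcar x -> hcar y -> hcar z ->
  hip z (x + y) = hip z x + hip z y.
Proof.
move=> Mx My Mz; have Mxy := submoduleD sM Mx My.
by rewrite -(prehilbert_herm pM Mxy) // hipDl // starD !prehilbert_herm.
Qed.

Lemma hipZr a x z : hcar x -> hcar z -> hip z (a *: x) = hip z x * star a.
Proof.
move=> Mx Mz; have Max := submoduleZ sM a Mx.
by rewrite -(prehilbert_herm pM Max) // hipZl // star_mul prehilbert_herm.
Qed.

Lemma hipNr x z : hcar x -> hcar z -> hip z (- x) = - hip z x.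
Proof. by move=> Mx Mz; rewrite -scaleN1r hipZr // starN star1 mulrN1. Qed.

Lemma hnorm_ge0 (N : hmod A) (x : N) : 0 <= hnorm x.
Proof. exact: sqrtr_ge0. Qed.

Lemma sqr_hnorm (N : hmod A) (x : N) : hnorm x ^+ 2 = nrm (hip x x).
Proof. by rewrite sqr_sqrtr //; exact: nrm_ge0. Qed.

Lemma hnormN x : hcar x -> hnorm (- x) = hnorm x.
Proof.
move=> Mx; rewrite /hnorm hipNl ?hipNr ?opprK //; exact: submoduleN.
Qed.

Lemma hnormB x y : hcar x -> hcar y -> hnorm (x - y) = hnorm (y - x).
Proof. by move=> Mx My; rewrite -hnormN ?opprB //; exact: submoduleB. Qed.

Lemma ler_hnormZ a x : hcar x -> hnorm (a *: x) <= nrm a * hnorm x.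
Proof.
move=> Mx; have Max := submoduleZ sM a Mx.
rewrite -(@ler_pXn2r _ 2) ?nnegrE ?mulr_ge0 ?hnorm_ge0 ?nrm_ge0 //.
rewrite exprMn !sqr_hnorm hipZl // hipZr // mulrA.
apply: le_trans (ler_nrmM _ _) _; rewrite nrm_star expr2 [leRHS]mulrAC.
by apply: ler_wpM2r; [exact: nrm_ge0|exact: ler_nrmM].
Qed.

Lemma hnorm0 : hnorm (0 : M) = 0.
Proof. by rewrite /hnorm hip0l ?normr0 ?sqrtr0 //; exact: submodule0. Qed.

(** For [N > |<y,y>|] and [b = N^-1 <x,y>], the positive elements [<x - b y, x - b y>] and
    [b (N - <y,y>) b^*] add up to [<x,x> - b <x,y>^*]; monotonicity of the norm then gives
    [|<x,y>|^2 <= |<x,x>| N]. *)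
Lemma cauchy_schwarz x y : hcar x -> hcar y ->
  nrm (hip x y) <= hnorm x * hnorm y.
Proof.
move=> Mx My.
rewrite -(@ler_pXn2r _ 2) ?nnegrE ?mulr_ge0 ?hnorm_ge0 ?nrm_ge0 //.
rewrite exprMn !sqr_hnorm; set X := nrm (hip x x); set Y := nrm (hip y y).
have X0 : 0 <= X by exact: nrm_ge0.
have Y0 : 0 <= Y by exact: nrm_ge0.
set a := hip x y.
(* Taking [N] strictly above [Y] avoids dividing by a vanishing [Y]; afterwards [N] tends to [Y]. *)
suff key N : Y < N -> nrm a ^+ 2 <= X * N.
  apply/ler_addgt0Pr => e e0.
  have X1 : 0 < X + 1 by lra.
  have eX : 0 < e / (X + 1) by rewrite divr_gt0.
  apply: le_trans (key (Y + e / (X + 1)) _) _; first by lra.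
  rewrite mulrDr lerD // mulrCA -[leRHS]mulr1 ler_wpM2l ?(ltW e0) //.
  by rewrite ler_pdivrMr //; lra.
move=> YN; have N0 : 0 < N by exact: le_lt_trans YN.
pose b : A := (N^-1)%:C *: a.
have Mby := submoduleZ sM b My.
have pos1 := prehilbert_pos pM (submoduleB sM Mx Mby).
have pos2 : spos (b * (sc N - hip y y) * star b).
  apply/spos_conj/spos_sub; last exact: ltW.
  exact: prehilbert_herm.
have bb : b * sc N * star b = b * star a.
  rewrite cscalerAr mulr1 cscalerAl -cscalerAr; congr (_ * _).
  by rewrite starZr scalerA -rmorphM /= divff ?gt_eqF ?scale1r.
have ab : a * star b = b * star a by rewrite starZr cscalerAr cscalerAl.
have eq : hip (x - b *: y) (x - b *: y) + b * (sc N - hip y y) * star b =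
    hip x x - b * star a.
  have Mnby := submoduleN sM Mby; have Mxby := submoduleB sM Mx Mby.
  rewrite hipDl // hipNl // !hipDr // !hipNr // !hipZr // !hipZl // -/a.
  rewrite -(prehilbert_herm pM Mx My) -/a mulrBr mulrBl bb ab.
  by rewrite subrK.
have ba : b * star a = (N^-1)%:C *: (a * star a) by rewrite cscalerAl.
have pba : spos (b * star a).
  by rewrite ba; apply: sposZ; [rewrite invr_ge0 ltW|exact: spos_mulstar].
have /(spos_nrm_le pba) : spos (hip x x - b * star a).
  by rewrite -eq; exact: sposD.
rewrite ba nrmZ nrmMstar ger0_norm ?invr_ge0 ?(ltW N0) //.
by rewrite mulrC ler_pdivrMr.
Qed.

Lemma ler_hnormD x y : hcar x -> hcar y -> hnorm (x + y) <= hnorm x + hnorm y.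
Proof.
move=> Mx My; have Mxy := submoduleD sM Mx My.
rewrite -(@ler_pXn2r _ 2) ?nnegrE ?addr_ge0 ?hnorm_ge0 //.
rewrite sqr_hnorm hipDl // !hipDr // sqrrD !sqr_hnorm.
have h1 := cauchy_schwarz Mx My.
have h2 : nrm (hip y x) <= hnorm x * hnorm y.
  by rewrite -(prehilbert_herm pM Mx My) nrm_star.
have h3 := ler_nrmD (hip x x + hip x y) (hip y x + hip y y).
have h4 := ler_nrmD (hip x x) (hip x y).
have h5 := ler_nrmD (hip y x) (hip y y).
rewrite mulr2n; lra.
Qed.

Lemma ler_hnormB x y : hcar x -> hcar y -> hnorm (x - y) <= hnorm x + hnorm y.
Proof.
move=> Mx My; rewrite -(hnormN My); apply: ler_hnormD => //.
exact: submoduleN.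
Qed.

Lemma ler_hnorm_dist x y z : hcar x -> hcar y -> hcar z ->
  hnorm (x - z) <= hnorm (x - y) + hnorm (y - z).
Proof.
move=> Mx My Mz; rewrite -(subrKA y).
by apply: ler_hnormD; exact: submoduleB.
Qed.

Lemma ler_hnorm_sum (n : nat) (f : 'I_n -> M) : (forall i, hcar (f i)) ->
  hnorm (\sum_(i < n) f i) <= \sum_(i < n) hnorm (f i).
Proof.
elim: n f => [|n IH] f Mf; first by rewrite !big_ord0 hnorm0.
rewrite !big_ord_recr /=; apply: le_trans (ler_hnormD _ _) _ => //.
  by apply: submodule_sum.
by rewrite lerD2r; apply: IH.
Qed.
End Theory.
End PreHilbert.

(** * The Hilbert module l_2(A) *)

Section SequenceSpace.
Context {R : realType} {A : cstarAlgType R}.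
Implicit Types (a : A) (x y z : nat -> A^o) (m n : nat).

Lemma nrm_cvgMl a (u : nat -> A) (l : A) :
  u @ \oo --> l -> (fun n => a * u n) @ \oo --> a * l.
Proof.
move=> /nrm_cvgP ul; apply/nrm_cvgP => e e0.
have a1 : 0 < nrm a + 1 by have := nrm_ge0 a; lra.
have [|N HN] := ul (e / (nrm a + 1)); first by rewrite divr_gt0.
exists N => n /HN; rewrite ltr_pdivlMr // -mulrBr => lt.
apply: le_lt_trans (ler_nrmM _ _) (le_lt_trans _ lt).
by rewrite mulrC ler_wpM2l ?nrm_ge0 // lerDl.
Qed.

Lemma nrm_cvg_star (u : nat -> A) (l : A) :
  u @ \oo --> l -> (fun n => star (u n)) @ \oo --> star l.
Proof.
move=> /nrm_cvgP ul; apply/nrm_cvgP => e /ul[N HN].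
by exists N => n /HN; rewrite -starB nrm_star.
Qed.

(** Defined on all sequences, so that Cauchy-Schwarz and the triangle inequality are available for
    blocks of partial sums before any convergence is known. *)
Definition seg m n : hmod A := @Hmod R A (nat -> A^o) setT
  (fun x y => \sum_(m <= k < n) (x k : A) * star (y k : A)).

Lemma seg_prehilbert m n : prehilbert (seg m n).
Proof.
split=> //= [a x y z _ _ _|x y _ _|x _].
- rewrite mulr_sumr -big_split /=; apply: eq_bigr => k _.
  by rewrite -[(a *: x + y) k]/(a * x k + y k) mulrDl mulrA.
- rewrite star_sum; apply: eq_bigr => k _.
  by rewrite star_mul starK.
- by apply: spos_sum => k _; exact: spos_mulstar.
Qed.

Lemma seg_diff_pos x m n m' n' : (m' <= m)%N -> (m <= n)%N -> (n <= n')%N ->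
  spos (@hip R A (seg m' n') x x - @hip R A (seg m n) x x).
Proof.
move=> m'm mn nn'; rewrite /= (big_cat_nat m'm) ?(leq_trans mn) //=.
rewrite [\sum_(m <= k < n') _](big_cat_nat mn) //= addrCA.
rewrite [X in X - _]addrC addrK.
by apply: sposD; apply: spos_sum => k _; exact: spos_mulstar.
Qed.

Notation segn m n x := (@hnorm R A (seg m n) x).

Lemma segn_mono x m n m' n' : (m' <= m)%N -> (n <= n')%N ->
  segn m n x <= segn m' n' x.
Proof.
move=> m'm nn'; have [nm|mn] := ltnP n m.
  rewrite {1}/hnorm /= big_geq ?(ltnW nm) // normr0 sqrtr0.
  exact: hnorm_ge0.
rewrite -(@ler_pXn2r _ 2) ?nnegrE ?hnorm_ge0 // !sqr_hnorm.
apply: spos_nrm_le; last exact: seg_diff_pos.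
exact: (prehilbert_pos (seg_prehilbert m n)).
Qed.

Lemma segn_coord x k : segn k k.+1 x = nrm (x k : A).
Proof.
apply/eqP; rewrite -(@eqrXn2 _ 2) ?hnorm_ge0 ?nrm_ge0 //.
by rewrite sqr_hnorm /= big_nat1 nrmMstar.
Qed.

(** Turns convergence of each coordinate into convergence on a finite block, for the completeness
    proof. *)
Lemma segn_le_sum x m n : segn m n x <= \sum_(m <= k < n) nrm (x k : A).
Proof.
have S0 l : 0 <= \sum_(m <= k < l) nrm (x k : A).
  by apply: sumr_ge0 => k _; exact: nrm_ge0.
rewrite -(@ler_pXn2r _ 2) ?nnegrE ?hnorm_ge0 // sqr_hnorm /=.
have [nm|mn] := leqP n m; first by rewrite !big_geq // nrm0 expr0n.
elim: n mn => // n IH; rewrite ltnS leq_eqVlt => /predU1P[->|mn].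
  by rewrite !big_nat1 nrmMstar.
rewrite !big_nat_recr ?(ltnW mn) //= (le_trans (ler_nrmD _ _)) //.
rewrite nrmMstar; have := IH mn; have := S0 n; have := nrm_ge0 (x n : A).
set s := \sum_(m <= k < n) nrm _; set r := nrm (x n : A); nra.
Qed.

(** The squared seminorm of a block is the norm of a difference of partial sums, so this is the
    Cauchy criterion, phrased with seminorms that obey the triangle inequality. *)
Lemma l2P x : @hcar R A (l2 A) x <-> (forall e : R, 0 < e ->
  exists N : nat, forall n, (N <= n)%N -> segn N n x < e).
Proof.
split=> [cv e e0|cau].
  have e2 : 0 < e ^+ 2 by rewrite exprn_gt0.
  have [N HN] := nrm_cvg_cauchy cv e2.
  exists N => n Nn; rewrite -(@ltr_pXn2r _ 2) ?nnegrE ?hnorm_ge0 ?(ltW e0) //.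
  rewrite sqr_hnorm /=; have := HN n N Nn (leqnn N).
  rewrite -!(big_mkord xpredT (fun k => x k * star (x k))).
  by rewrite (big_cat_nat (leq0n N) Nn) /= addrC addrK.
apply: nrm_cauchy_cvg => e e0.
have [|N HN] := cau (Num.sqrt (e / 2)); first by rewrite sqrtr_gt0 divr_gt0.
have near n : (N <= n)%N ->
    nrm (\sum_(k < n) x k * star (x k) - \sum_(k < N) x k * star (x k)) < e / 2.
  move=> Nn; have := HN n Nn.
  rewrite -(@ltr_pXn2r _ 2) ?nnegrE ?hnorm_ge0 ?sqrtr_ge0 // sqr_hnorm /=.
  rewrite sqr_sqrtr ?divr_ge0 ?ltW //.
  rewrite -!(big_mkord xpredT (fun k => x k * star (x k))).
  by rewrite (big_cat_nat (leq0n N) Nn) /= [X in nrm (X - _)]addrC addrK.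
exists N => m n Nm Nn; rewrite -(subrKA (\sum_(k < N) x k * star (x k))).
apply: le_lt_trans (ler_nrmD _ _) _; rewrite [e]splitr ltrD ?near //.
by rewrite nrmB near.
Qed.

Lemma l2_submodule : submodule (@hcar R A (l2 A)).
Proof.
split=> // [|a x y /l2P lx /l2P ly].
  apply/l2P => e e0; exists 0%N => n _.
  by rewrite (hnorm0 (seg_prehilbert 0 n)).
apply/l2P => e e0.
have a1 : 0 < nrm a + 1 by have := nrm_ge0 a; lra.
have [|N HN] := lx (e / 2 / (nrm a + 1)); first by rewrite !divr_gt0.
have [|N' HN'] := ly (e / 2); first by rewrite divr_gt0.
exists (maxn N N') => n; rewrite geq_max => /andP[Nn N'n].
have pS := seg_prehilbert (maxn N N') n.
apply: le_lt_trans (ler_hnormD pS _ _) _ => //.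
rewrite [e]splitr; apply: ltrD.
  apply: le_lt_trans (ler_hnormZ pS _ _) _ => //.
  have := HN n Nn; rewrite ltr_pdivlMr // => lt; apply: le_lt_trans _ lt.
  rewrite mulrC; apply: ler_pM; rewrite ?hnorm_ge0 ?nrm_ge0 ?lerDl //.
  by apply: segn_mono => //; exact: leq_maxl.
apply: le_lt_trans (HN' n N'n); apply: segn_mono => //; exact: leq_maxr.
Qed.

(** By Cauchy-Schwarz, a block of the series is at most the product of the block seminorms of [x]
    and [y]; far out, the first is below [e / 2] and the second at most 1. *)
Lemma l2_hip_cvg x y : @hcar R A (l2 A) x -> @hcar R A (l2 A) y ->
  (fun n => @hip R A (seg 0 n) x y) @ \oo --> (@hip R A (l2 A) x y : A).
Proof.
move=> /l2P lx /l2P ly.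
have -> : (fun n => @hip R A (seg 0 n) x y) =
    (fun n => \sum_(k < n) (x k : A) * star (y k : A)).
  by apply/funext => n /=; rewrite big_mkord.
suff : cvgn (fun n => \sum_(k < n) (x k : A) * star (y k : A)) by [].
apply: nrm_cauchy_cvg => e e0.
have [|N HN] := lx (e / 2); first by rewrite divr_gt0.
have [N' HN'] := ly _ ltr01.
pose M := maxn N N'.
have near n : (M <= n)%N ->
    nrm (\sum_(k < n) (x k : A) * star (y k : A)
      - \sum_(k < M) (x k : A) * star (y k : A)) < e / 2.
  move=> Mn; rewrite -!(big_mkord xpredT (fun k => (x k : A) * star (y k : A))).
  rewrite (big_cat_nat (leq0n M) Mn) /= [X in nrm (X - _)]addrC addrK.
  apply: le_lt_trans (cauchy_schwarz (seg_prehilbert M n) _ _) _ => //.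
  have h1 : segn M n x < e / 2.
    apply: le_lt_trans (HN n _); last by apply: leq_trans Mn; exact: leq_maxl.
    by apply: segn_mono => //; exact: leq_maxl.
  have h2 : segn M n y <= 1.
    apply: ltW; apply: le_lt_trans (HN' n _); last first.
      by apply: leq_trans Mn; exact: leq_maxr.
    by apply: segn_mono => //; exact: leq_maxr.
  by apply: le_lt_trans h1; rewrite -[leRHS]mulr1 ler_wpM2l ?hnorm_ge0.
exists M => m n Mm Mn.
rewrite -(subrKA (\sum_(k < M) (x k : A) * star (y k : A))).
apply: le_lt_trans (ler_nrmD _ _) _; rewrite [e]splitr ltrD ?near //.
by rewrite nrmB near.
Qed.

(** The axioms hold for the blocks and pass to the limit, positivity because the cone is closed. *)
Lemma l2_prehilbert : prehilbert (l2 A).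
Proof.
have sub := l2_submodule; split=> // [a x y z lx ly lz|x y lx ly|x lx].
- have laxy : @hcar R A (l2 A) (a *: x + y) by case: sub => _ _; exact.
  apply: (cvg_unique _ (l2_hip_cvg laxy lz)); first exact: norm_hausdorff.
  have -> : (fun n => @hip R A (seg 0 n) (a *: x + y) z) =
      (fun n => a * @hip R A (seg 0 n) x z + @hip R A (seg 0 n) y z).
    by apply/funext => n; rewrite (prehilbert_linear (seg_prehilbert 0 n)).
  apply: (@cvgD _ A); last exact: l2_hip_cvg.
  by apply: nrm_cvgMl; exact: l2_hip_cvg.
- apply: (cvg_unique _ _ (l2_hip_cvg ly lx)); first exact: norm_hausdorff.
  have -> : (fun n => @hip R A (seg 0 n) y x) =
      (fun n => star (@hip R A (seg 0 n) x y)).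
    by apply/funext => n; rewrite (prehilbert_herm (seg_prehilbert 0 n)).
  by apply: nrm_cvg_star; exact: l2_hip_cvg.
- apply: spos_closed => e e0.
  have /nrm_cvgP/(_ e e0)[N HN] := l2_hip_cvg lx lx.
  exists (@hip R A (seg 0 N) x x); last by rewrite nrmB ltW // HN.
  exact: (prehilbert_pos (seg_prehilbert 0 N)).
Qed.

(** [<x,x>] minus the product on a block is a limit of positive elements, hence positive. *)
Lemma segn_le_l2 m n x : @hcar R A (l2 A) x ->
  segn m n x <= @hnorm R A (l2 A) x.
Proof.
move=> lx; rewrite -(@ler_pXn2r _ 2) ?nnegrE ?hnorm_ge0 // !sqr_hnorm.
have [nm|mn] := leqP n m.
  by rewrite [leLHS]/= big_geq // nrm0 nrm_ge0.
apply: spos_nrm_le; first exact: (prehilbert_pos (seg_prehilbert m n)).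
apply: spos_closed => e e0.
have /nrm_cvgP/(_ e e0)[N HN] := l2_hip_cvg lx lx.
exists (@hip R A (seg 0 (maxn N n)) x x - @hip R A (seg m n) x x).
  by apply: seg_diff_pos => //; [exact: ltnW|exact: leq_maxr].
by rewrite opprB subrKA nrmB ltW // HN // leq_maxl.
Qed.

Lemma l2_hnorm_le x (c : R) : 0 <= c -> @hcar R A (l2 A) x ->
  (forall n, segn 0 n x <= c) -> @hnorm R A (l2 A) x <= c.
Proof.
move=> c0 lx le; rewrite -(@ler_pXn2r _ 2) ?nnegrE ?hnorm_ge0 // sqr_hnorm.
apply/ler_addgt0Pr => e e0.
have /nrm_cvgP/(_ e e0)[N HN] := l2_hip_cvg lx lx.
rewrite -(subrK (@hip R A (seg 0 N) x x) (@hip R A (l2 A) x x)) addrC.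
rewrite (le_trans (ler_nrmD _ _)) // lerD //; last by rewrite nrmB ltW // HN.
by rewrite -sqr_hnorm lerXn2r // nnegrE hnorm_ge0.
Qed.

Lemma l2_coord_le x k : @hcar R A (l2 A) x ->
  nrm (x k : A) <= @hnorm R A (l2 A) x.
Proof. by move=> lx; rewrite -segn_coord; exact: segn_le_l2. Qed.

Lemma l2_complete : hcomplete (l2 A).
Proof.
move=> u lu cu; have pl := l2_prehilbert; have sl := l2_submodule.
have lD i j : @hcar R A (l2 A) (u i - u j) by exact: (submoduleB sl).
have ccv k : cvgn (fun j => u j k : A).
  apply: nrm_cauchy_cvg => e /cu[N HN]; exists N => m n Nm Nn.
  by apply: le_lt_trans (l2_coord_le k (lD m n)) (HN _ _ Nm Nn).
pose l : nat -> A^o := fun k => limn (fun j => u j k : A).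
have segl m n (e : R) : 0 < e -> exists N, forall j, (N <= j)%N ->
    segn m n (u j - l) < e.
  suff sumcv : 0 < e -> exists N, forall j, (N <= j)%N ->
      \sum_(m <= k < n) nrm ((u j - l) k : A) < e.
    move=> /sumcv[N HN]; exists N => j /HN; apply: le_lt_trans.
    exact: segn_le_sum.
  elim: n e => [|n IH] e e0; first by exists 0%N => j _; rewrite big_geq.
  have [nm|mn] := ltnP n m; first by exists 0%N => j _; rewrite big_geq.
  have e20 : 0 < e / 2 by rewrite divr_gt0.
  have [N HN] := IH _ e20; have /nrm_cvgP/(_ _ e20)[N' HN'] := ccv n.
  exists (maxn N N') => j; rewrite geq_max => /andP[Nj N'j].
  by rewrite big_nat_recr //= [e]splitr ltrD ?HN ?HN'.
(* The index [N] is uniform in the block: [u j] is compared with a term far enough out, depending on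
   the block, to be close to [l] there. *)
have near (e : R) : 0 < e -> exists N, forall j m n, (N <= j)%N ->
    segn m n (u j - l) <= e.
  move=> e0; have [N HN] := cu _ e0; exists N => j m n Nj.
  apply/ler_addgt0Pr => d d0; have [N' HN'] := segl m n d d0.
  have pS := seg_prehilbert m n.
  apply: le_trans (@ler_hnorm_dist _ _ _ pS _ (u (maxn N N')) _ _ _ _) _ => //.
  apply: lerD; last by rewrite ltW // HN' // leq_maxr.
  apply: le_trans (segn_le_l2 _ _ (lD _ _)) _.
  by rewrite ltW // HN // leq_maxl.
have ll : @hcar R A (l2 A) l.
  apply/l2P => e e0; have [|N HN] := near (e / 2); first by rewrite divr_gt0.
  have /l2P := lu N; have e20 : 0 < e / 2 by rewrite divr_gt0.
  move=> /(_ _ e20)[N' HN']; exists N' => n N'n.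
  have pS := seg_prehilbert N' n.
  (* On tail blocks [l] inherits smallness from the single element [u N] of the space. *)
  have -> : l = u N - (u N - l) by rewrite opprB addrC subrK.
  apply: le_lt_trans (ler_hnormB pS _ _) _ => //.
  by rewrite [e]splitr ltr_leD ?HN' ?HN.
exists l => //; apply/cvgrPdist_le => e e0.
have [N HN] := near e e0; exists N => // j /= Nj.
rewrite sub0r normrN ger0_norm ?hnorm_ge0 //.
apply: l2_hnorm_le; [exact: ltW|exact: (submoduleB sl)|].
by move=> n; exact: HN.
Qed.

Lemma l2_hilbert : hilbert_module (l2 A).
Proof.
have [sl lin herm pos] := l2_prehilbert; split=> //.
- by move=> x /pos/sposP.
- move=> x lx x0; apply/funext => k; apply: nrm_eq0; apply/eqP.
  rewrite eq_le nrm_ge0 andbT (le_trans (l2_coord_le k lx)) //.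
  by rewrite /hnorm x0 normr0 sqrtr0.
- exact: l2_complete.
Qed.
End SequenceSpace.

(** * Bounded operators *)

Section Operators.
Context {R : realType} {A : cstarAlgType R}.
Implicit Types M N P : hmod A.

Lemma bop_car M N (T : M -> N) x : bounded_op T -> hcar x -> hcar (T x).
Proof. by case=> + _ _; exact. Qed.

Section Linear.
Variables (M N : hmod A) (T : M -> N).
Hypotheses (pM : prehilbert M) (bT : bounded_op T).
Let sM := prehilbert_submodule pM.

Lemma bopD x y : hcar x -> hcar y -> T (x + y) = T x + T y.
Proof.
by case: bT => _ lT _ Mx My; rewrite -[x in LHS]scale1r lT // scale1r.
Qed.

Lemma bop0 : T 0 = 0.
Proof.
have M0 := submodule0 sM.
by apply: (addrI (T 0)); rewrite -bopD // !addr0.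
Qed.

Lemma bopZ a x : hcar x -> T (a *: x) = a *: T x.
Proof.
case: (bT) => _ lT _ Mx; rewrite -[a *: x]addr0 lT ?bop0 ?addr0 //.
exact: submodule0.
Qed.

Lemma bopN x : hcar x -> T (- x) = - T x.
Proof. by move=> Mx; rewrite -scaleN1r bopZ // scaleN1r. Qed.

Lemma bopB x y : hcar x -> hcar y -> T (x - y) = T x - T y.
Proof.
by move=> Mx My; rewrite bopD ?bopN //; exact: submoduleN.
Qed.

Lemma bop_sum (n : nat) (f : 'I_n -> M) : (forall i, hcar (f i)) ->
  T (\sum_(i < n) f i) = \sum_(i < n) T (f i).
Proof.
elim: n f => [|n IH] f Mf; first by rewrite !big_ord0 bop0.
by rewrite !big_ord_recr /= bopD ?IH //; exact: submodule_sum.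
Qed.

(** [bounded_op] does not fix the sign of its constant; a nonnegative one lets bounds be
    multiplied. *)
Lemma bop_bound : exists2 c : R, 0 <= c &
  forall x, hcar x -> hnorm (T x) <= c * hnorm x.
Proof.
case: bT => _ _ [c cT]; exists `|c| => // x Mx.
apply: le_trans (cT x Mx) _; rewrite ler_wpM2r ?hnorm_ge0 //.
exact: ler_norm.
Qed.
End Linear.

Lemma bop_id M : bounded_op (fun x : M => x).
Proof. by split=> //; exists 1 => x _; rewrite mul1r. Qed.

Lemma bop_zero M N : prehilbert N -> bounded_op (fun _ : M => 0 : N).
Proof.
move=> pN; split=> [x _|a x y _ _|].
- exact: submodule0 (prehilbert_submodule pN).
- by rewrite scaler0 addr0.
- by exists 0 => x _; rewrite hnorm0 // mul0r.
Qed.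

Lemma bop_comp M N P (S : N -> P) (T : M -> N) : prehilbert N ->
  bounded_op S -> bounded_op T -> bounded_op (fun x => S (T x)).
Proof.
move=> pN bS bT; split=> [x Mx|a x y Mx My|].
- by do 2 apply: bop_car => //.
- have [cT lT _] := bT; have [_ lS _] := bS.
  by rewrite lT // lS //; exact: cT.
- have [c c0 cS] := bop_bound bS; have [d d0 dT] := bop_bound bT.
  exists (c * d) => x Mx; have NTx := bop_car bT Mx.
  by apply: le_trans (cS _ NTx) _; rewrite -mulrA ler_wpM2l ?dT.
Qed.

Lemma bop_add M N (S T : M -> N) : prehilbert N ->
  bounded_op S -> bounded_op T -> bounded_op (fun x => S x + T x).
Proof.
move=> pN bS bT; have sN := prehilbert_submodule pN.
split=> [x Mx|a x y Mx My|].
- by apply: submoduleD => //; apply: bop_car.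
- by have [_ -> // _] := bT; have [_ -> // _] := bS; rewrite scalerDr addrACA.
- have [c c0 cS] := bop_bound bS; have [d d0 dT] := bop_bound bT.
  exists (c + d) => x Mx; rewrite mulrDl.
  apply: le_trans (ler_hnormD pN _ _) _; try exact: bop_car.
  by apply: lerD; [exact: cS|exact: dT].
Qed.

Lemma bop_sub M N (S T : M -> N) : prehilbert N ->
  bounded_op S -> bounded_op T -> bounded_op (fun x => S x - T x).
Proof.
move=> pN bS bT; have sN := prehilbert_submodule pN.
split=> [x Mx|a x y Mx My|].
- by apply: submoduleB => //; apply: bop_car.
- have [_ -> // _] := bT; have [_ -> // _] := bS.
  by rewrite scalerBr opprD addrACA.
- have [c c0 cS] := bop_bound bS; have [d d0 dT] := bop_bound bT.
  exists (c + d) => x Mx; rewrite mulrDl.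
  apply: le_trans (ler_hnormB pN _ _) _; try exact: bop_car.
  by apply: lerD; [exact: cS|exact: dT].
Qed.

Lemma hnorm_eq0 M (x : M) : hilbert_module M -> hcar x -> hnorm x = 0 -> x = 0.
Proof.
move=> hM Mx x0; apply: hilbert_def => //; apply: nrm_eq0.
by rewrite -sqr_hnorm x0 expr0n.
Qed.

Lemma hnorm_small M (x : M) (c : R) : hilbert_module M -> hcar x ->
  (forall e : R, 0 < e -> hnorm x <= c * e) -> x = 0.
Proof.
move=> hM Mx small; apply: hnorm_eq0 => //; apply/eqP.
rewrite eq_le hnorm_ge0 andbT; have [c0|c0] := leP c 0.
  by apply: le_trans (small 1 ltr01) _; rewrite mulr1.
apply/ler_addgt0Pr => e e0; rewrite add0r.
have := small (e / c) (divr_gt0 e0 c0).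
by rewrite mulrC divfK // gt_eqF.
Qed.

(** All four summands of the final decompositions are presented as kernels, so their closedness
    comes from here. *)
Lemma kernel_closed M N (T : M -> N) : prehilbert M -> hilbert_module N ->
  bounded_op T -> closed_submodule [set x | hcar x /\ T x = 0].
Proof.
move=> pM hN bT; have sM := prehilbert_submodule pM; split.
  split=> [x []//||a x y [Mx Tx] [My Ty]].
    by split; [exact: submodule0|exact: bop0 bT].
  have [_ _ /(_ a x y Mx My) Maxy] := sM; split=> //.
  by have [_ -> // _] := bT; rewrite Tx Ty scaler0 addr0.
move=> x Mx approx; split=> //.
have [c c0 cT] := bop_bound bT.
apply: (@hnorm_small _ _ c) => //; first exact: bop_car.
move=> e /approx[y [My Ty] xy].
have -> : T x = T (x - y) by rewrite (bopB pM bT) // Ty subr0.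
apply: le_trans (cT _ (submoduleB sM Mx My)) _.
by rewrite ler_wpM2l // ltW.
Qed.

Lemma hilbert_hsub M (S : set M) : hilbert_module M -> closed_submodule S ->
  hilbert_module (hsub S).
Proof.
move=> hM [sS clS]; have [SM _ _] := sS.
case: (hM) => sM lin herm pos def compl.
split=> //=.
- by case: sS => _ S0 lS; split=> // x.
- by move=> a x y z /SM ? /SM ? /SM ?; exact: lin.
- by move=> x y /SM ? /SM ?; exact: herm.
- by move=> x /SM ?; exact: pos.
- by move=> x /SM ?; exact: def.
- move=> u Su cu; have [l Ml ul] := compl u (fun n => SM _ (Su n)) cu.
  exists l => //; apply: clS => // e e0.
  have /cvgrPdist_lt/(_ e e0)[N _ /(_ N (leqnn N))] := ul.
  rewrite /= sub0r normrN ger0_norm ?hnorm_ge0 // => lt.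
  exists (u N); first exact: Su.
  by rewrite (hnormB (hilbert_prehilbert hM) Ml (SM _ (Su N))).
Qed.

(** Fixed point iteration for the contraction sending [x] to [z + B x], started at [z]. *)
Lemma neumann_ex M (B : M -> M) (b : R) : hilbert_module M -> bounded_op B ->
  0 <= b -> b < 1 -> (forall x, hcar x -> hnorm (B x) <= b * hnorm x) ->
  forall z, hcar z -> exists2 x, hcar x & x = z + B x.
Proof.
move=> hM bB b0 b1 Bb z Mz.
have pM := hilbert_prehilbert hM; have sM := prehilbert_submodule pM.
pose u := fix u n := if n is m.+1 then z + B (u m) else z.
have Mu n : hcar (u n).
  by elim: n => [|n IH] //=; apply: submoduleD => //; exact: bop_car.
(* The sum of the geometric series [|B z| b^k], which bounds every [|u k - u 0|]; the induction
   closes by [b D + (1 - b) D = D]. *)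
pose D := hnorm (B z) / (1 - b).
have b1' : 0 < 1 - b by rewrite subr_gt0.
have Bdist x y : hcar x -> hcar y ->
    hnorm (z + B x - (z + B y)) <= b * hnorm (x - y).
  move=> Mx My; rewrite opprD addrACA subrr add0r -(bopB pM bB) //.
  by apply: Bb; exact: submoduleB.
have D0 : 0 <= D by rewrite divr_ge0 ?hnorm_ge0 ?ltW.
have u0 k : hnorm (u k - u 0%N) <= D.
  case: k => [|k]; first by rewrite subrr hnorm0.
  elim: k => [|k IH].
    rewrite /= addrC addKr /D ler_pdivlMr //.
    by rewrite ler_piMr ?hnorm_ge0 // gerBl.
  apply: le_trans (ler_hnorm_dist pM (Mu k.+2) (Mu 1%N) (Mu 0%N)) _.
  have h1 : hnorm (u k.+2 - u 1%N) <= b * D.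
    by apply: le_trans (Bdist _ _ (Mu k.+1) (Mu 0%N)) _; rewrite ler_wpM2l.
  have h2 : hnorm (u 1%N - u 0%N) = D * (1 - b).
    by rewrite /= addrC addKr divfK // gt_eqF.
  by rewrite h2; lra.
have udist n k : hnorm (u (n + k)%N - u n) <= b ^+ n * D.
  elim: n => [|n IH]; first by rewrite add0n expr0 mul1r.
  apply: le_trans (Bdist _ _ (Mu (n + k)%N) (Mu n)) _.
  by rewrite exprS -mulrA ler_wpM2l.
have small (e : R) : 0 < e -> exists n, forall k, hnorm (u (n + k)%N - u n) < e.
  move=> e0; have D1 : 0 < D + 1 by lra.
  have : (fun n => b ^+ n) @ \oo --> (0 : R).
    by apply: cvg_expr; rewrite ger0_norm.
  move=> /cvgrPdist_lt/(_ (e / (D + 1)))[|n _ /(_ n (leqnn n)) /=].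
    by rewrite divr_gt0.
  rewrite sub0r normrN ger0_norm ?exprn_ge0 // ltr_pdivlMr // => lt.
  exists n => k; apply: le_lt_trans (udist n k) (le_lt_trans _ lt).
  by rewrite ler_wpM2l ?exprn_ge0 // lerDl.
have [//|e e0|x Mx ux] := hilbert_complete hM (u := u).
  have [|n nk] := small (e / 2); first by rewrite divr_gt0.
  exists n => i j ni nj; rewrite -(subnKC ni) -(subnKC nj).
  apply: le_lt_trans (ler_hnorm_dist pM (Mu _) (Mu n) (Mu _)) _.
  by rewrite [e]splitr ltrD ?nk // hnormB // nk.
exists x => //; apply/subr0_eq; have MBx := bop_car bB Mx.
have MzBx := submoduleD sM Mz MBx.
apply: (@hnorm_small _ _ 2) => // [|e e0]; first exact: submoduleB.
have /cvgrPdist_lt/(_ e e0)[n _ near] := ux.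
have := near n (leqnn n); have := near n.+1 (leqnSn n).
rewrite /= !sub0r !normrN !ger0_norm ?hnorm_ge0 // => h1 h2.
apply: le_trans (ler_hnorm_dist pM Mx (Mu n.+1) MzBx) _.
rewrite (hnormB pM Mx) //; have := Bdist _ _ (Mu n) Mx; rewrite /= in h1 *.
have := hnorm_ge0 (u n - x); nra.
Qed.

(** A vector fixed by [B] vanishes, so solutions are unique and the chosen solution map is linear;
    [|V z| <= |z| + b |V z|] bounds it by [1 / (1 - b)]. *)
Lemma neumann M (B : M -> M) (b : R) : hilbert_module M -> bounded_op B ->
  0 <= b -> b < 1 -> (forall x, hcar x -> hnorm (B x) <= b * hnorm x) ->
  exists2 V : M -> M, bounded_op V & forall z, hcar z -> V z = z + B (V z).
Proof.
move=> hM bB b0 b1 Bb.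
have pM := hilbert_prehilbert hM; have sM := prehilbert_submodule pM.
have /choice[V VP] z : exists x, hcar z -> hcar x /\ x = z + B x.
  have [Mz|nMz] := pselect (hcar z); last by exists 0 => /nMz.
  by have [x Mx ex] := neumann_ex hM bB b0 b1 Bb Mz; exists x.
have MV z : hcar z -> hcar (V z) by case/VP.
have b1' : 0 < 1 - b by rewrite subr_gt0.
exists V => [|z /VP[//]]; split=> [//|a x y Mx My|].
  have Maxy : hcar (a *: x + y) by have [_ _] := sM; exact.
  have [MV1 e1] := VP _ Maxy.
  have [MVx ex] := VP _ Mx; have [MVy ey] := VP _ My.
  have MV2 : hcar (a *: V x + V y) by have [_ _] := sM; exact.
  apply/subr0_eq/hnorm_eq0 => //; first exact: submoduleB.
  set d := _ - _; have Md : hcar d by exact: submoduleB.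
  have ed : d = B d.
    have -> : B d = B (V (a *: x + y)) - (a *: B (V x) + B (V y)).
      by rewrite (bopB pM bB MV1 MV2); have [_ -> // _] := bB.
    have -> : d = (a *: x + y + B (V (a *: x + y))) -
        (a *: (x + B (V x)) + (y + B (V y))) by rewrite -e1 -ex -ey.
    by rewrite scalerDr (addrACA (a *: x)) opprD addrACA subrr add0r.
  have := Bb d Md; rewrite -ed -subr_ge0 -{2}[hnorm d]mul1r -mulrBl.
  rewrite nmulr_rge0 ?subr_lt0 // => d0.
  by apply/eqP; rewrite eq_le d0 hnorm_ge0.
exists (1 - b)^-1 => z Mz; have [MVz ez] := VP _ Mz.
rewrite mulrC ler_pdivlMr // mulrBr mulr1 lerBlDr {1}ez.
apply: le_trans (ler_hnormD pM Mz (bop_car bB MVz)) _.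
by rewrite lerD2l mulrC Bb.
Qed.

(* Baire category: some closed ball of [M] is contained in the closure of
   [V m], the set of combinations of the generators with coefficients of norm
   at most [m], since otherwise nested balls shrink to a point in no [V m]. *)
Lemma generators_somewhere_dense M (V : nat -> set M) : hilbert_module M ->
  (forall x, hcar x -> exists m, V m x) ->
  exists (m : nat) (x : M) (r : R), [/\ hcar x, 0 < r &
    forall y, hcar y -> hnorm (y - x) <= r ->
      forall e, 0 < e -> exists2 v, V m v & hnorm (y - v) <= e].
Proof.
move=> hM cover; apply: contrapT => nex.
have pM := hilbert_prehilbert hM; have sM := prehilbert_submodule pM.
(* Pairs are a centre and a radius. The halvings keep the new closed ball inside the old one, and
   the last clause makes it miss [V m]. *)
have step (m : nat) (p : M * R) : exists q : M * R, hcar p.1 -> 0 < p.2 ->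
    [/\ hcar q.1, 0 < q.2, q.2 <= p.2 / 2, hnorm (q.1 - p.1) <= p.2 / 2 &
        forall v, V m v -> q.2 < hnorm (q.1 - v)].
  have [[Mp p0]|np] := pselect (hcar p.1 /\ 0 < p.2); last first.
    by exists p => ? ?; case: np.
  apply: contrapT => nq; apply: nex; exists m, p.1, (p.2 / 2).
  split=> //; first by rewrite divr_gt0.
  move=> y My yp e e0; apply: contrapT => nv; apply: nq.
  exists (y, Num.min e (p.2 / 2)) => _ _; split=> //=.
  - by rewrite lt_min e0 divr_gt0.
  - by rewrite ge_min lexx orbT.
  - move=> v Vv; rewrite gt_min ltNge; apply/orP; left; apply/negP => le.
    by apply: nv; exists v.
have /choice[f fP] : forall mp : nat * (M * R), exists q : M * R,
    hcar mp.2.1 -> 0 < mp.2.2 ->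
    [/\ hcar q.1, 0 < q.2, q.2 <= mp.2.2 / 2,
        hnorm (q.1 - mp.2.1) <= mp.2.2 / 2 &
        forall v, V mp.1 v -> q.2 < hnorm (q.1 - v)].
  by move=> [m p]; exact: step.
pose s := fix s n := if n is m.+1 then f (m, s m) else (0 : M, 1 : R).
have sP n : hcar (s n).1 /\ 0 < (s n).2.
  elim: n => [|n [Mn n0]] /=; first by split; [exact: submodule0|exact: ltr01].
  by have [] := fP (n, s n) Mn n0.
have Ms n : hcar (s n).1 by case: (sP n).
have sS n : [/\ (s n.+1).2 <= (s n).2 / 2,
    hnorm ((s n.+1).1 - (s n).1) <= (s n).2 / 2 &
    forall v, V n v -> (s n.+1).2 < hnorm ((s n.+1).1 - v)].
  by case: (sP n) => Mn n0; have [] := fP (n, s n) Mn n0.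
have nested n k :
    hnorm ((s (n + k)%N).1 - (s n).1) <= (s n).2 - (s (n + k)%N).2.
  elim: k => [|k IH]; first by rewrite addn0 !subrr hnorm0.
  rewrite addnS; have [h1 h2 _] := sS (n + k)%N.
  apply: le_trans (ler_hnorm_dist pM (Ms _) (Ms (n + k)%N) (Ms n)) _; lra.
have rad n : (s n).2 <= 2^-1 ^+ n.
  elim: n => [|n IH]; first by rewrite expr0.
  have [h _ _] := sS n; apply: le_trans h _.
  by rewrite exprS mulrC ler_wpM2l // invr_ge0.
have nested' n k : hnorm ((s (n + k)%N).1 - (s n).1) <= (s n).2.
  apply: le_trans (nested n k) _; rewrite gerBl.
  by case: (sP (n + k)%N) => _ /ltW.
have [//|e e0|x Mx sx] := hilbert_complete hM (u := fun n => (s n).1).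
  have : (fun n => 2^-1 ^+ n) @ \oo --> (0 : R).
    by apply: cvg_expr; rewrite ger0_norm ?invr_ge0 // invf_lt1 ?ltr1n.
  move=> /cvgrPdist_lt/(_ (e / 2))[|n _ /(_ n (leqnn n)) /=].
    by rewrite divr_gt0.
  rewrite sub0r normrN ger0_norm ?exprn_ge0 ?invr_ge0 // => lt.
  exists n => i j ni nj; rewrite -(subnKC ni) -(subnKC nj).
  apply: le_lt_trans (ler_hnorm_dist pM (Ms _) (Ms n) (Ms _)) _.
  rewrite [e]splitr ltrD // ?(le_lt_trans _ lt) //; first last.
    by rewrite (hnormB pM) // (le_trans (nested' _ _)).
  by rewrite (le_trans (nested' _ _)).
(* The limit [x] lies in all the balls, in particular in the one chosen to miss the set [V m] that
   contains [x]. *)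
have [m Vx] := cover x Mx; have [_ _ /(_ x Vx)] := sS m.
apply/negP; rewrite -leNgt; apply/ler_addgt0Pr => e e0.
have /cvgrPdist_lt/(_ e e0)[N _ /(_ (m.+1 + N)%N (leq_addl _ _))] := sx.
rewrite /= sub0r normrN ger0_norm ?hnorm_ge0 // => lt.
apply: le_trans (ler_hnorm_dist pM (Ms m.+1) (Ms (m.+1 + N)%N) Mx) _.
by rewrite lerD // ?(ltW lt) // (hnormB pM) // nested'.
Qed.
End Operators.

(** * Finitely generated and compact operators *)

Section FinitelyGenerated.
Context {R : realType} {A : cstarAlgType R}.
Implicit Types M N P : hmod A.
Local Notation sc t := ((t)%:C *: (1 : A)).

(** An approximate open mapping theorem: on some ball of radius [r] coefficients bounded by [m]
    suffice; subtracting those of the centre moves the ball to the origin at the bound [2 m], and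
    scaling gives [C = 2 m / r]. *)
Lemma fg_hilbert_coef_bound M (n : nat) (g : 'I_n -> M) : hilbert_module M ->
  (forall i, hcar (g i)) ->
  (forall x, hcar x -> exists a : 'I_n -> A, x = \sum_(i < n) a i *: g i) ->
  exists2 C : R, 0 <= C & forall y, hcar y -> forall e : R, 0 < e ->
    exists a : 'I_n -> A, (forall i, nrm (a i) <= C * hnorm y) /\
      hnorm (y - \sum_(i < n) a i *: g i) <= e.
Proof.
move=> hM Mg gen; have pM := hilbert_prehilbert hM.
have sM := prehilbert_submodule pM.
have Mlin (a : 'I_n -> A) : hcar (\sum_(i < n) a i *: g i).
  by apply: submodule_sum => // i _; exact: submoduleZ.
pose V m : set M := [set x | exists2 a : 'I_n -> A,
  forall i, nrm (a i) <= m%:R & x = \sum_(i < n) a i *: g i].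
have [x Mx|m [x [r [Mx r0 dense]]]] := @generators_somewhere_dense _ _ M V hM.
  have [a ea] := gen x Mx.
  (* A natural number above the norms of all the coefficients. *)
  exists (\max_(i < n) `|Num.ceil (nrm (a i))|)%N; exists a => // i.
  apply: le_trans (ceil_ge _) _; rewrite -[leLHS]ger0_norm; last first.
    by rewrite ler0z ceil_ge0 (lt_le_trans _ (nrm_ge0 _)) ?ltrN10.
  by rewrite -intr_norm -natr_absz ler_nat (leq_bigmax i).
have dense0 y : hcar y -> hnorm y <= r -> forall e : R, 0 < e ->
    exists a : 'I_n -> A, (forall i, nrm (a i) <= 2 * m%:R) /\
      hnorm (y - \sum_(i < n) a i *: g i) <= e.
  move=> My yr e e0; have e20 : 0 < e / 2 by rewrite divr_gt0.
  have Mxy := submoduleD sM Mx My.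
  have [||v1 [a1 a1m ->] d1] := dense (x + y) _ _ _ e20 => //.
    by rewrite addrC addKr.
  have [||v2 [a2 a2m ->] d2] := dense x _ _ _ e20 => //.
    by rewrite subrr (hnorm0 pM) ltW.
  exists (fun i => a1 i - a2 i); split=> [i|].
    by have := ler_nrmB (a1 i) (a2 i); have := a1m i; have := a2m i; lra.
  have -> : \sum_(i < n) (a1 i - a2 i) *: g i =
      \sum_(i < n) a1 i *: g i - \sum_(i < n) a2 i *: g i.
    by rewrite -sumrB; apply: eq_bigr => i _; rewrite scalerBl.
  have -> : y - (\sum_(i < n) a1 i *: g i - \sum_(i < n) a2 i *: g i) =
      (x + y - \sum_(i < n) a1 i *: g i) - (x - \sum_(i < n) a2 i *: g i).
    rewrite -[x + y - _]addrA [in RHS]opprD addrACA subrr add0r !opprK opprB.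
    by rewrite -addrA [- _ + _]addrC.
  apply: le_trans (ler_hnormB pM _ _) _; try exact: (submoduleB sM).
  lra.
exists (2 * m%:R / r) => [|y My e e0].
  by rewrite divr_ge0 ?mulr_ge0 ?ler0n // ltW.
have [y0|ny0] := eqVneq (hnorm y) 0.
  exists (fun=> 0); split=> [i|]; first by rewrite nrm0 y0 mulr0.
  rewrite big1 ?subr0 => [|i _]; last by rewrite scale0r.
  by rewrite y0 ltW.
have yp : 0 < hnorm y by rewrite lt_neqAle eq_sym ny0 hnorm_ge0.
pose t := r / hnorm y; have t0 : 0 < t by rewrite divr_gt0.
have ti0 : 0 <= t^-1 by rewrite invr_ge0 ltW.
have [||a [am ad]] := dense0 (sc t *: y) _ _ (e * t) (mulr_gt0 e0 t0).
- exact: submoduleZ.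
- apply: le_trans (ler_hnormZ pM _ My) _.
  by rewrite -ler_pdivlMr // -/t nrm_alg // ltW.
exists (fun i => (t^-1)%:C *: a i); split=> [i|].
  have -> : 2 * m%:R / r * hnorm y = t^-1 * (2 * m%:R).
    by rewrite /t; field; rewrite ny0 gt_eqF.
  by rewrite nrmZ ger0_norm // ler_wpM2l.
have -> : y - \sum_(i < n) ((t^-1)%:C *: a i) *: g i =
    sc t^-1 *: (sc t *: y - \sum_(i < n) a i *: g i).
  rewrite scalerBr scalerA cscalerAl mul1r scalerA -rmorphM /= mulVf ?gt_eqF //.
  rewrite !scale1r scaler_sumr; congr (_ - _); apply: eq_bigr => i _.
  by rewrite scalerA cscalerAl mul1r.
apply: le_trans (ler_hnormZ pM _ _) _.
  by apply: (submoduleB sM) => //; exact: submoduleZ.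
apply: le_trans (_ : t^-1 * (e * t) <= _); last by rewrite mulrC mulfK ?gt_eqF.
by apply: ler_pM; rewrite ?nrm_ge0 ?hnorm_ge0 ?nrm_alg.
Qed.

(** The point is that [C] is independent of [T], so an operator small on the generators is small in
    norm. The error of the approximate combination is absorbed by the boundedness of [T]. *)
Lemma fg_op_bound M : fg_hilbert M ->
  exists (n : nat) (g : 'I_n -> M) (C : R), [/\ 0 <= C, forall i, hcar (g i) &
    forall (N : hmod A) (T : M -> N), prehilbert N -> bounded_op T ->
      forall y, hcar y ->
        hnorm (T y) <= C * (\sum_(i < n) hnorm (T (g i))) * hnorm y].
Proof.
move=> [hM [n [g [Mg gen]]]]; have pM := hilbert_prehilbert hM.
have sM := prehilbert_submodule pM.
have [C C0 approx] := fg_hilbert_coef_bound hM Mg gen.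
exists n, g, C; split=> // N T pN bT y My.
have [c c0 cT] := bop_bound bT.
apply/ler_addgt0Pr => e e0; have c1 : 0 < c + 1 by lra.
have [a [aC ay]] := approx y My (e / (c + 1)) (divr_gt0 e0 c1).
have Mag i : hcar (a i *: g i) by exact: submoduleZ.
set v := \sum_(i < n) _ in ay; have Mv : hcar v by exact: submodule_sum.
have -> : T y = T v + T (y - v) by rewrite (bopB pM bT) // addrC subrK.
apply: le_trans (ler_hnormD pN _ _) _.
- exact: bop_car.
- by apply: bop_car => //; exact: submoduleB.
apply: lerD; last first.
  apply: le_trans (cT _ (submoduleB sM My Mv)) _.
  apply: le_trans (_ : (c + 1) * (e / (c + 1)) <= _).
    by apply: ler_pM; rewrite ?hnorm_ge0 ?lerDl.
  by rewrite mulrC divfK // gt_eqF.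
rewrite (bop_sum pM bT) //; apply: le_trans (ler_hnorm_sum pN _) _.
  by move=> i; exact: bop_car.
rewrite mulrAC mulr_sumr; apply: ler_sum => i _.
rewrite (bopZ pM bT) //; apply: le_trans (ler_hnormZ pN _ _) _.
  exact: bop_car.
by rewrite ler_wpM2r ?hnorm_ge0.
Qed.
End FinitelyGenerated.

(** * Truncations and compact operators on [l_2(A)] *)

Section Compact.
Context {R : realType} {A : cstarAlgType R}.

(** As [K - T] is bounded, the infimum in [opnorm] is over a nonempty set, so some admissible
    constant lies below [e]. *)
Lemma compact_approx (H : hmod A) (K : H -> H) (e : R) : prehilbert H ->
  compact_op K -> 0 < e ->
  exists2 T : H -> H, fg_op T & exists2 c : R, 0 <= c < e &
    forall x, hcar x -> hnorm (K x - T x) <= c * hnorm x.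
Proof.
move=> pH [bK apK] /apK[T fT lt]; exists T => //; have [bT _] := fT.
have [c0 c00 c0P] := bop_bound (bop_sub pH bK bT).
have [|c [c1 cP] ce] := inf_lt _ lt; first by exists c0; split.
by exists c => //; rewrite c1.
Qed.

Definition trunc (n : nat) (x : l2 A) : l2 A :=
  fun k => if (k < n)%N then 0 else (x : nat -> A^o) k.

Notation segn m n x := (@hnorm R A (seg m n) x).

Lemma segn_trunc (n m m' : nat) (x : l2 A) :
  segn m m' (trunc n x) <= segn (maxn m n) m' x.
Proof.
rewrite -(@ler_pXn2r _ 2) ?nnegrE ?hnorm_ge0 // !sqr_hnorm /=.
suff -> : \sum_(m <= k < m') (trunc n x k : A) * star (trunc n x k : A) =
    \sum_(maxn m n <= k < m') (x k : A) * star (x k : A) by [].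
rewrite [RHS]big_geq_mkord [LHS]big_geq_mkord.
rewrite (bigID (fun k : 'I_m' => (k < n)%N)) /= big1 ?add0r => [|k]; last first.
  by move=> /andP[_ kn]; rewrite /trunc kn mul0r.
apply: eq_big => [k|k /andP[_ /negPf kn]]; first by rewrite geq_max -leqNgt.
by rewrite /trunc kn.
Qed.

Lemma trunc_car n (x : l2 A) : hcar x -> hcar (trunc n x).
Proof.
move=> /l2P lx; apply/l2P => e /lx[N HN]; exists N => m Nm.
apply: le_lt_trans (segn_trunc _ _ _ _) (le_lt_trans _ (HN m Nm)).
by apply: segn_mono => //; exact: leq_maxl.
Qed.

Lemma ler_hnorm_trunc n (x : l2 A) : hcar x -> hnorm (trunc n x) <= hnorm x.
Proof.
move=> lx; apply: l2_hnorm_le; [exact: hnorm_ge0|exact: trunc_car|move=> m].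
by apply: le_trans (segn_trunc _ _ _ _) _; exact: segn_le_l2.
Qed.

Lemma trunc_linear n (a : A) (x y : l2 A) :
  trunc n (a *: x + y) = a *: trunc n x + trunc n y.
Proof.
apply/funext => k.
rewrite -[RHS]/(a *: trunc n x k + trunc n y k) /trunc.
by case: ifP => _ //; rewrite scaler0 addr0.
Qed.

Lemma trunc_bop n : bounded_op (@trunc n).
Proof.
split=> [x|a x y _ _|]; [exact: trunc_car|exact: trunc_linear|].
by exists 1 => x lx; rewrite mul1r ler_hnorm_trunc.
Qed.

Lemma truncK n (x : l2 A) : trunc n (trunc n x) = trunc n x.
Proof. by apply/funext => k; rewrite /trunc; case: (k < n)%N. Qed.

Lemma trunc_small (x : l2 A) (e : R) : hcar x -> 0 < e ->
  exists N, forall n, (N <= n)%N -> hnorm (trunc n x) <= e.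
Proof.
move=> lx e0; have /l2P/(_ e e0)[N HN] := lx; exists N => n Nn.
apply: l2_hnorm_le; [exact: ltW|exact: trunc_car|move=> m].
apply: le_trans (segn_trunc _ _ _ _) _; rewrite max0n.
have [Nm|mN] := leqP N m.
  by apply: le_trans (ltW (HN m Nm)); exact: segn_mono.
by rewrite /hnorm /= big_geq ?normr0 ?sqrtr0 ?ltW // (leq_trans (ltnW mN)).
Qed.

Definition l2_basis (i : nat) : l2 A := fun k => if k == i then 1 else 0.

Lemma l2_basis_car i : hcar (l2_basis i).
Proof.
apply/l2P => e e0; exists i.+1 => n _.
rewrite /hnorm /= big_nat_cond big1 ?normr0 ?sqrtr0 // => k.
move=> /andP[/andP[ik _] _].
by rewrite /l2_basis gtn_eqF // mul0r.
Qed.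

(** On the kernel of [trunc n] this writes [x] in the first [n] basis vectors; it serves for [Ker q]
    and for the values of [F] on [Ker (q F)]. *)
Lemma l2_finite_sum n (x : l2 A) :
  x - trunc n x = \sum_(i < n) (x (nat_of_ord i) : A) *: l2_basis i.
Proof.
apply/funext => k.
rewrite fct_sumE -[LHS]/(x k - trunc n x k) /trunc.

have [kn|nk] := ltnP k n.
  rewrite subr0 (bigD1 (Ordinal kn)) //= big1 ?addr0 => [|i ik].
    by rewrite -[RHS]/(_ * _) /l2_basis eqxx mulr1.
  rewrite -[LHS]/(_ * _) /l2_basis eq_sym.
  by rewrite -(inj_eq val_inj) in ik; rewrite (negPf ik) mulr0.
rewrite subrr big1 // => i _.
by rewrite -[LHS]/(_ * _) /l2_basis gtn_eqF ?mulr0 // (leq_trans (ltn_ord i)).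
Qed.

Lemma compact_trunc_small (K : l2 A -> l2 A) (e : R) : compact_op K -> 0 < e ->
  exists n, forall x, hcar x -> hnorm (trunc n (K x)) <= e * hnorm x.
Proof.
move=> cK e0; have pl := @l2_prehilbert R A.
have e20 : 0 < e / 2 by rewrite divr_gt0.
have [T [bT [M [f1 [f2 [fM bf1 bf2 Tf]]]]] [c /andP[c0 ce] cP]] :=
  compact_approx pl cK e20.
have [k [g [C [C0 Mg bound]]]] := fg_op_bound fM.
have [d d0 dP] := bop_bound bf1.
(* With [k] generators, [f1] bounded by [d] and the constant [C], this accuracy on the generators
   contributes at most [e / 2]; the [+ 1] keeps the denominator positive. *)
have e'0 : 0 < e / 2 / (C * k%:R * d + 1).
  by rewrite divr_gt0 // ltr_wpDl // !mulr_ge0.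
have [N small] : exists n, forall i, hnorm (trunc n (f2 (g i))) <=
    e / 2 / (C * k%:R * d + 1).
  have /choice[N NP] i := trunc_small (bop_car bf2 (Mg i)) e'0.
  exists (\max_(i < k) N i)%N => i; apply: NP.
  exact: (leq_bigmax i).
exists N => x lx; have Mx := bop_car bf1 lx.
have lKx := bop_car cK.1 lx; have lTx := bop_car bT lx.
have -> : trunc N (K x) = trunc N (K x - T x) + trunc N (f2 (f1 x)).
  by rewrite -Tf // (bopB pl (trunc_bop N)) // subrK.
have lf := bop_car bf2 Mx.
apply: le_trans (ler_hnormD pl _ _) _.
- by apply: trunc_car; apply: (submoduleB l2_submodule).
- exact: trunc_car.
rewrite [e]splitr mulrDl; apply: lerD.
  apply: le_trans (ler_hnorm_trunc _ _) _.
    exact: (submoduleB l2_submodule).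
  by apply: le_trans (cP x lx) _; rewrite ler_wpM2r ?hnorm_ge0 // ltW.
apply: le_trans (bound _ _ pl (bop_comp pl (trunc_bop N) bf2) _ Mx) _.
set S := \sum_(i < k) _.
have Sk : S <= k%:R * (e / 2 / (C * k%:R * d + 1)).
  rewrite mulr_natl -[X in _ *+ X]card_ord -sumr_const.
  by apply: ler_sum => i _; exact: small.
have S0 : 0 <= S by apply: sumr_ge0 => i _; exact: hnorm_ge0.
apply: (@le_trans _ _ (C * (k%:R * (e / 2 / (C * k%:R * d + 1))) *
  (d * hnorm x))).
  by apply: ler_pM; rewrite ?mulr_ge0 ?hnorm_ge0 ?dP // ler_wpM2l.
rewrite mulrA ler_wpM2r ?hnorm_ge0 //.
have D0 : 0 < C * k%:R * d + 1 by rewrite ltr_wpDl // !mulr_ge0.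
have -> : C * (k%:R * (e / 2 / (C * k%:R * d + 1))) * d =
   (C * k%:R * d) * (e / 2) / (C * k%:R * d + 1).
  by field; rewrite gt_eqF.
by rewrite ler_pdivrMr // mulrC ler_wpM2l ?(ltW e20) // lerDl.
Qed.
End Compact.

(** * Noether decompositions *)

Section SubAndSum.
Context {R : realType} {A : cstarAlgType R}.
Implicit Types M N P : hmod A.

Lemma bop_corestrict M N (S : set N) (T : M -> N) : bounded_op T ->
  (forall x, hcar x -> S (T x)) -> @bounded_op R A M (hsub S) T.
Proof. by case=> _ lT bT ST; split. Qed.

Lemma bop_restrict M N (S : set M) (T : M -> N) : S `<=` @hcar R A M ->
  bounded_op T -> @bounded_op R A (hsub S) N T.
Proof.
move=> SM [cT lT [c bT]]; split=> [x /SM|a x y /SM ? /SM|].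
- exact: cT.
- exact: lT.
- by exists c => x /SM; exact: bT.
Qed.

(** The product on the sum dominates that of each component, and the norm is monotone on positive
    elements. *)
Lemma bop_fst M N : prehilbert M -> prehilbert N ->
  @bounded_op R A (hsum M N) M (fun p => p.1).
Proof.
move=> pM pN; split=> [p [] //|//|]; exists 1 => p [Mp Np]; rewrite mul1r.
rewrite -(@ler_pXn2r _ 2) ?nnegrE ?hnorm_ge0 // !sqr_hnorm /=.
apply: spos_nrm_le; first exact: (prehilbert_pos pM).
by rewrite addrC addKr; exact: (prehilbert_pos pN).
Qed.

Lemma bop_snd M N : prehilbert M -> prehilbert N ->
  @bounded_op R A (hsum M N) N (fun p => p.2).
Proof.
move=> pM pN; split=> [p [] //|//|]; exists 1 => p [Mp Np]; rewrite mul1r.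
rewrite -(@ler_pXn2r _ 2) ?nnegrE ?hnorm_ge0 // !sqr_hnorm /=.
apply: spos_nrm_le; first exact: (prehilbert_pos pN).
by rewrite addrK; exact: (prehilbert_pos pM).
Qed.

Lemma bop_pair M N P (S : P -> M) (T : P -> N) : bounded_op S -> bounded_op T ->
  @bounded_op R A P (hsum M N) (fun x => (S x, T x)).
Proof.
move=> bS bT; split=> [x Px|a x y Px Py|].
- by split; exact: bop_car.
- by have [_ -> // _] := bS; have [_ -> // _] := bT.
- have [c c0 cS] := bop_bound bS; have [d d0 dT] := bop_bound bT.
  exists (c + d) => x Px; apply: le_trans (_ : hnorm (S x) + hnorm (T x) <= _).
    rewrite -(@ler_pXn2r _ 2) ?nnegrE ?addr_ge0 ?hnorm_ge0 // sqr_hnorm /=.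
    apply: le_trans (ler_nrmD _ _) _; rewrite -!sqr_hnorm.
    by have := hnorm_ge0 (S x); have := hnorm_ge0 (T x); nra.
  by rewrite mulrDl lerD ?cS ?dT.
Qed.

Lemma fin_generatedU (M : hmod A) (n k : nat) (u : 'I_n -> M) (v : 'I_k -> M) :
  (forall i, hcar (u i)) -> (forall i, hcar (v i)) ->
  (forall x, hcar x -> exists (a : 'I_n -> A) (b : 'I_k -> A),
     x = \sum_(i < n) a i *: u i + \sum_(i < k) b i *: v i) ->
  fin_generated M.
Proof.
move=> Mu Mv gen.
exists (n + k)%N, (fun i : 'I_(n + k) =>
  match fintype.split i with inl j => u j | inr j => v j end).
split=> [i|x /gen[a [b ->]]]; first by case: fintype.split.
exists (fun i : 'I_(n + k) =>
  match fintype.split i with inl j => a j | inr j => b j end).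
rewrite big_split_ord /=; congr (_ + _); apply: eq_bigr => i _.
  by rewrite (unsplitK (inl i)).
by rewrite (unsplitK (inr i)).
Qed.
End SubAndSum.

(** * The right parametrix and the decompositions it yields *)

Section Noether.
Context {R : realType} {A : cstarAlgType R}.
Let H := l2 A.
Let pH : prehilbert H := l2_prehilbert.
Let hH : hilbert_module H := l2_hilbert.
Let sH := prehilbert_submodule pH.

(** With [y = V (q x)], one has [y = q x + q K y] and [F G y = y - K y]; applying [q] to both and
    using [q q = q] gives [q F G y = q x]. *)
Lemma fredholm_right_parametrix (F : H -> H) : fredholm_op F ->
  exists (n : nat) (S : H -> H), [/\ bounded_op S,
    forall x, hcar x -> S (trunc n x) = S x &
    forall x, hcar x -> trunc n (F (S x)) = trunc n x].
Proof.
move=> [bF [G [bG cK _]]].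
have half0 : 0 < 2^-1 :> R by rewrite invr_gt0.
have [n small] := compact_trunc_small cK half0.
have bB := bop_comp pH (@trunc_bop R A n) cK.1.
have half1 : 2^-1 < 1 :> R by rewrite invf_lt1 // ltr1n.
have [V bV eV] := neumann hH bB (ltW half0) half1 small.
exists n, (fun x => G (V (trunc n x))); split=> [|x lx|x lx].
- exact: (bop_comp pH bG (bop_comp pH bV (@trunc_bop R A n))).
- by rewrite truncK.
have lt_ := trunc_car (n := n) lx; have lV := bop_car bV lt_.
have lFG := bop_car bF (bop_car bG lV); have lK := bop_car cK.1 lV.
set y := V (trunc n x) in lV lFG lK *.
have -> : F (G y) = y - (y - F (G y)) by rewrite opprB addrC subrK.
have ey : y = trunc n x + trunc n (y - F (G y)) by exact: eV.
rewrite (bopB pH (@trunc_bop R A n)) // {1}ey (bopD (@trunc_bop R A n)) //.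
  by rewrite !truncK addrK.
exact: trunc_car.
Qed.

Section Decompositions.
Variables (F S G : H -> H) (n : nat).
Hypotheses (bF : bounded_op F) (bS : bounded_op S) (bG : bounded_op G).
Hypothesis cK : compact_op (fun x => x - G (F x)).
Hypothesis Strunc : forall x, hcar x -> S (trunc n x) = S x.
Hypothesis truncFS : forall x, hcar x -> trunc n (F (S x)) = trunc n x.

Let bq := @trunc_bop R A n.
(** The idempotent with image [N1] and kernel [M1]. The images [M1] of [S F] and [M2] of [F S] are
    written as kernels of the complementary idempotents, so that [kernel_closed] applies. *)
Let Q (x : H) : H := x - S (F x).
Let bQ : bounded_op Q := bop_sub pH (bop_id H) (bop_comp pH bS bF).
Let M1 : set H := [set x | hcar x /\ x - S (F x) = 0].
Let N1 : set H := [set x | hcar x /\ trunc n (F x) = 0].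
Let M2 : set H := [set x | hcar x /\ x - F (S x) = 0].
Let N2 : set H := [set x | hcar x /\ trunc n x = 0].

Let M1_closed : closed_submodule M1 := kernel_closed pH hH bQ.
Let N1_closed : closed_submodule N1 := kernel_closed pH hH (bop_comp pH bq bF).
Let M2_closed : closed_submodule M2 :=
  kernel_closed pH hH (bop_sub pH (bop_id H) (bop_comp pH bF bS)).
Let N2_closed : closed_submodule N2 := kernel_closed pH hH bq.

(** Inserting [q], [S F S = S q F S = S q = S]; hence [S F] and [F S] are idempotent. *)
Lemma SFS x : hcar x -> S (F (S x)) = S x.
Proof.
move=> lx; rewrite -Strunc ?truncFS ?Strunc //.
by do 2 apply: bop_car => //.
Qed.

Lemma SN2 x : N2 x -> S x = 0.
Proof. by move=> [lx x0]; rewrite -Strunc // x0 (bop0 pH bS). Qed.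

Lemma FN1 x : N1 x -> N2 (F x).
Proof. by move=> [lx x0]; split=> //; exact: bop_car. Qed.

Lemma SFN1 x : N1 x -> S (F x) = 0.
Proof. by move=> /FN1/SN2. Qed.

(** [q F Q = q F - q F S F = 0], by [truncFS] at [F x]. *)
Lemma QN1 x : hcar x -> N1 (Q x).
Proof.
move=> lx; split; first exact: bop_car.
have lFx := bop_car bF lx; have lSFx := bop_car bS lFx.
rewrite (bopB pH bF) // (bopB pH bq) ?truncFS ?subrr //.
exact: bop_car.
Qed.

Lemma Q_id x : N1 x -> Q x = x.
Proof. by move=> Nx; rewrite /Q SFN1 // subr0. Qed.

(** [S F] is the identity on [M1] and zero on [N1], and [x = S F x + Q x]. *)
Lemma source_decomposition : direct_decomposition M1 N1.
Proof.
split=> // [|x lx].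
  apply/seteqP; split=> [x [[lx x0] Nx]|_ ->].
    by move: x0; rewrite SFN1 // subr0.
  by split; apply: submodule0; [case: M1_closed|case: N1_closed].
have lSFx := bop_car bS (bop_car bF lx).
exists (S (F x)), (Q x); split; last by rewrite addrC subrK.
  by split=> //; rewrite SFS ?subrr //; exact: bop_car.
exact: QN1.
Qed.

Lemma target_decomposition : direct_decomposition M2 N2.
Proof.
split=> // [|x lx].
  apply/seteqP; split=> [x [[lx x0] Nx]|_ ->].
    by move: x0; rewrite SN2 // (bop0 pH bF) subr0.
  by split; apply: submodule0; [case: M2_closed|case: N2_closed].
have lFSx := bop_car bF (bop_car bS lx).
exists (F (S x)), (x - F (S x)); split; last by rewrite addrC subrK.
  by split=> //; rewrite SFS ?subrr.
split; first exact: (submoduleB sH).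
by rewrite (bopB pH bq) // truncFS ?subrr.
Qed.

Lemma N2_fg : fg_hilbert (hsub N2).
Proof.
split; first exact: hilbert_hsub.
exists n, (fun i => l2_basis i); split=> [i|x [lx x0]].
  split; first exact: l2_basis_car.
  apply/funext => k; rewrite /trunc /l2_basis; case: ltnP => // nk.
  by rewrite gtn_eqF // (leq_trans (ltn_ord i)).
exists (fun i => (x : nat -> A^o) i).
by have := l2_finite_sum n x; rewrite x0 subr0.
Qed.

(* On [N1], the identity [Q] is [Q (G F + T)] up to an operator of norm less
   than one, where [T] is finitely generated and [F] has values in [N2]. *)
Lemma N1_fg : fg_hilbert (hsub N1).
Proof.
split; first exact: hilbert_hsub.
have [q q0 qQ] := bop_bound bQ; have q1 : 0 < q + 1 by lra.
(* As [q] bounds [Q], this accuracy makes [Q (1 - G F - T)] a contraction. *)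
have qi : 0 < (q + 1)^-1 by rewrite invr_gt0.
have [T [bT [M [f1 [f2 [fM bf1 bf2 Tf]]]]] [c /andP[c0 cq] cT]] :=
  compact_approx pH cK qi.
have [hM [k [g [Mg gen]]]] := fM.
have bKT := bop_sub pH cK.1 bT.
have qc1 : q * c < 1.
  have : c * (q + 1) < 1 by rewrite -ltr_pdivlMr // div1r.
  by nra.
apply: (@fin_generatedU _ _ (hsub N1) n k (fun i => Q (G (l2_basis i)))
  (fun j => Q (f2 (g j)))) => [i|j|x Nx].
- by apply: QN1; apply: bop_car => //; exact: l2_basis_car.
- by apply: QN1; exact: bop_car.
have [lx _] := Nx.
have QKT z : hcar z -> hnorm (Q (z - G (F z) - T z)) <= q * c * hnorm z.
  move=> lz; rewrite -mulrA; apply: le_trans (qQ _ _) _.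
    exact: bop_car bKT lz.
  by rewrite ler_wpM2l ?cT.
have bQKT := bop_comp pH bQ bKT.
(* Solves [y = x + Q (1 - G F - T) y]; both terms lie in [N1], so [y] does too and [Q y = y]. *)
have [y ly ey] := neumann_ex hH bQKT (mulr_ge0 q0 c0) qc1 QKT lx.
have lFy := bop_car bF ly; have lGFy := bop_car bG lFy.
have Ny : N1 y.
  rewrite ey; apply: submoduleD => //; first by case: N1_closed.
  by apply: QN1; exact: bop_car bKT ly.
have lTy := bop_car bT ly; have lKy := bop_car cK.1 ly.
have lKTy := bop_car bKT ly.
(* Obtained from the equation for [y] and [y = Q y]. The first term is a combination over the basis
   vectors because [F y] is in [N2], the second over the generators of [M]. *)
have ex : x = Q (G (F y)) + Q (f2 (f1 y)).
  rewrite -Tf // -(bopD bQ) //.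
  have -> : G (F y) + T y = y - (y - G (F y) - T y).
    by rewrite -[X in y - X]addrA -opprD subKr.
  rewrite (bopB pH bQ) // (Q_id Ny).
  by apply/eqP; rewrite eq_sym subr_eq -ey.
have [b eb] := gen _ (bop_car bf1 ly).
have bQG := bop_comp pH bQ bG; have bQf := bop_comp pH bQ bf2.
have pM := hilbert_prehilbert hM; have sM := prehilbert_submodule pM.
exists (fun i => (F y : nat -> A^o) i), b; rewrite ex; congr (_ + _).
  have eFy := l2_finite_sum n (F y); rewrite Ny.2 subr0 in eFy.
  rewrite [in LHS]eFy (bop_sum pH bQG) => [|i]; last first.
    by apply: (submoduleZ sH); exact: l2_basis_car.
  apply: eq_bigr => i _; rewrite (bopZ pH bQG) //; exact: l2_basis_car.
rewrite eb (bop_sum pM bQf) => [|i]; last exact: (submoduleZ sM).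
by apply: eq_bigr => i _; rewrite (bopZ pM bQf).
Qed.

Lemma inner_noether_of_parametrix : inner_noether F.
Proof.
exists M1, N1, M2, N2; split.
- exact: source_decomposition.
- exact: target_decomposition.
- exact: N1_fg.
- exact: N2_fg.
have sM1 : M1 `<=` @hcar R A H by move=> x [].
have sM2 : M2 `<=` @hcar R A H by move=> x [].
have sN1 : N1 `<=` @hcar R A H by move=> x [].
have M1E x : M1 x -> S (F x) = x by move=> [_ /subr0_eq].
have M2E x : M2 x -> F (S x) = x by move=> [_ /subr0_eq].
(* [F] sends [M1] to [M2], with inverse [S], and [N1] into [N2], so the off-diagonal entry
   vanishes. *)
exists F, (fun=> 0), F; split.
- split.
    apply: bop_corestrict; first exact: bop_restrict.
    move=> x M1x; split; first exact: (bop_car bF (sM1 _ M1x)).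
    by rewrite M1E ?subrr.
  exists S; split=> [||x /M2E] //.
  apply: bop_corestrict; first exact: bop_restrict.
  move=> x M2x; split; first exact: (bop_car bS (sM2 _ M2x)).
  by rewrite M2E ?subrr.
- by apply/bop_zero/hilbert_prehilbert/hilbert_hsub.
- by apply: bop_corestrict; [exact: bop_restrict|exact: FN1].
move=> x u M1x N1u; rewrite addr0 add0r (bopD bF) //; [exact: sM1|exact: sN1].
Qed.

(** The inverse sends [(z, u)] to [(S z + u, z - F (S z + u))]: [S] kills [N2], while [Q] kills the
    image of [S] and fixes [N1]. *)
Lemma external_noether_of_parametrix : external_noether F.
Proof.
have sN1 : N1 `<=` @hcar R A H by move=> x [].
have sN2 : N2 `<=` @hcar R A H by move=> x [].
have bE2 : @bounded_op R A (hsub N2) H (fun x => x).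
  exact: bop_restrict sN2 (bop_id H).
have bE3 : @bounded_op R A H (hsub N1) Q.
  by apply: bop_corestrict => //; exact: QN1.
have bI1 : @bounded_op R A (hsub N1) H (fun x => x).
  exact: bop_restrict sN1 (bop_id H).
have pN1 := hilbert_prehilbert N1_fg.1; have pN2 := hilbert_prehilbert N2_fg.1.
exists (hsub N2), (hsub N1), (fun x => x), Q.
split=> //; [exact: N2_fg|exact: N1_fg|].
have b1 := bop_fst pH pN2; have b2 := bop_snd pH pN2.
have c1 := bop_fst pH pN1; have c2 := bop_snd pH pN1.
split.
  apply: bop_pair.
    exact: (bop_add pH (bop_comp pH bF b1) (bop_comp pN2 bE2 b2)).
  exact: (bop_add pN1 (bop_comp pH bE3 b1) (bop_zero _ pN1)).
pose h (p : hsum H (hsub N1)) : H := S p.1 + p.2.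
have bh : bounded_op h.
  exact: (bop_add pH (bop_comp pH bS c1) (bop_comp pN1 bI1 c2)).
have bk : bounded_op (fun p : hsum H (hsub N1) => p.1 - F (h p) : H).
  exact: (bop_sub pH c1 (bop_comp pH bF bh)).
exists (fun p => (h p, p.1 - F (h p))); split.
(* The second component is in [N2], since [q F S z = q z] and [q F u = 0]. *)
- apply: bop_pair => //; apply: bop_corestrict => // -[z u] [/= lz Nu].
  have lu := sN1 u Nu; have lSz := bop_car bS lz; have lFSz := bop_car bF lSz.
  have lFu := bop_car bF lu.
  have lh : hcar (S z + u) by exact: (submoduleD sH).
  split; first exact: (submoduleB sH lz (bop_car bF lh)).
  rewrite /h /= (bopD bF) // (bopB pH bq) //; last exact: (submoduleD sH).
  by rewrite (bopD bq) // truncFS // Nu.2 addr0 subrr.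
- move=> [x v] [/= lx Nv]; have lv := sN2 v Nv; have lFx := bop_car bF lx.
  have -> : h (F x + v, Q x + 0) = x.
    by rewrite /h /= (bopD bS) // (SN2 Nv) !addr0 addrC subrK.
  by congr (_, _); rewrite addrC addKr.
- move=> [z u] [/= lz Nu]; have lu := sN1 u Nu; have lSz := bop_car bS lz.
  congr (_, _); first by rewrite addrC subrK.
  rewrite addr0 /h /= (bopD bQ) // (Q_id Nu) /Q SFS // subrr.
  by rewrite add0r.
Qed.
End Decompositions.
End Noether.

Theorem theorem5 (R : realType) (A : cstarAlgType R) (F : l2 A -> l2 A)
    (hF : fredholm_op F) :
  inner_noether F /\ external_noether F.
Proof.
have [n [S [bS Strunc truncFS]]] := fredholm_right_parametrix hF.
have [bF [G [bG _ cK]]] := hF.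
by split; [exact: (inner_noether_of_parametrix bF bS bG cK Strunc truncFS)
  |exact: (external_noether_of_parametrix bF bS bG cK Strunc truncFS)].
Qed.
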